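(* Let $d,d_0\in\mathbb{N}$ with $d\ge 2d_0-1$, let $a=(a_{ij})_{1\le i<j\le d_0}$ with $a_{ij}\ne0$ for all $j>i$, and let $\mathcal{H}_{\mathrm{FM}}(\bullet;a):\mathbb{R}^{d\times d_0}\to\mathbb{R}^{(d_0-1)d_0/2}$, $\mathcal{H}_{\mathrm{FM}}(P;a):=(a_{ij}\,p_i^{\mathrm T}p_j)_{1\le i<j\le d_0}$, where $p_1,\dots,p_{d_0}$ are the columns of $P$. Let $\ell:\mathbb{R}^{(d_0-1)d_0/2}\to\mathbb{R}$ be locally Lipschitz. Then the subdifferential chain rule of $f:=\ell\circ\mathcal{H}_{\mathrm{FM}}(\bullet;a)$ holds everywhere: for every $P\in\mathbb{R}^{d\times d_0}$, $$\partial_C f(P)=J_{\mathcal{H}_{\mathrm{FM}}(\bullet;a)}(P)^{\mathrm T}\,\partial_C\ell\bigl(\mathcal{H}_{\mathrm{FM}}(P;a)\bigr).$$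
   Context: $\mathbb{N}$ is the set of positive integers. Matrix spaces are identified with Euclidean spaces via the Frobenius inner product; $J_{\mathcal{H}}(x)$ denotes the Jacobian of $\mathcal{H}$ at $x$, and $J^{\mathrm T}S:=\{J^{\mathrm T}s:s\in S\}$. For a locally Lipschitz $f:\mathbb{R}^N\to\mathbb{R}$, the Clarke subdifferential at $x$ is $\partial_C f(x):=\operatorname{conv}\{s:\exists\, y_k\to x,\ f\text{ differentiable at each }y_k,\ \nabla f(y_k)\to s\}$. Entries indexed by pairs $i<j$ are ordered lexicographically. *)

(* Defs.v *)
From HB Require Import structures.
From mathcomp Require Import all_boot all_order all_algebra.
From mathcomp Require Import all_classical all_reals all_analysis.
Set Implicit Arguments.
Unset Strict Implicit.
Unset Printing Implicit Defensive.
Import Order.TTheory GRing.Theory Num.Theory.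
Import numFieldNormedType.Exports.
Local Open Scope classical_set_scope.
Local Open Scope ring_scope.

(* Vectors of R^N are rows 'rV[R]_N = 'M[R]_(1, N), so that the notions for
   functions on 'M[R]_(m, n) below apply to them as well. The norm on
   'M[R]_(m, n) is the maximum norm; being equivalent to the Frobenius norm, it
   yields the same limits, locally Lipschitz functions and differentials. *)

Definition locally_lipschitz (R : realType) (m n : nat) (f : 'M[R]_(m, n) -> R) :=
  forall x : 'M[R]_(m, n), exists2 U : set 'M[R]_(m, n), nbhs x U & [lipschitz f y | y in U].

(* The gradient for the Frobenius inner product, given by the partial
   derivatives; meaningful where f is differentiable. *)
Definition gradient (R : realType) (m n : nat) (f : 'M[R]_(m, n) -> R)
    (x : 'M[R]_(m, n)) : 'M[R]_(m, n) :=
  \matrix_(i, j) 'D_(delta_mx i j) f x.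

Definition convex_hull (R : realType) (V : lmodType R) (A : set V) : set V :=
  smallest (@convex_set R V) A.

Definition limiting_gradients (R : realType) (m n : nat)
    (f : 'M[R]_(m, n) -> R) (x : 'M[R]_(m, n)) : set 'M[R]_(m, n) :=
  [set s | exists y : nat -> 'M[R]_(m, n),
     [/\ y @ \oo --> x,
         forall k, differentiable f (y k) &
         (fun k => gradient f (y k)) @ \oo --> s]].

Definition clarke_subdiff (R : realType) (m n : nat)
    (f : 'M[R]_(m, n) -> R) (x : 'M[R]_(m, n)) : set 'M[R]_(m, n) :=
  convex_hull (limiting_gradients f x).

(* The Jacobian in the usual layout: row k is the gradient of the k-th component
   of H, with 'M[R]_(m, n) identified with R^(m * n) by mxvec, an isometry for
   the Frobenius inner product. The transposition is needed because the matrix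
   'J G p is the one for which 'd G p v = v *m 'J G p. *)
Definition jacobian_mx (R : realType) (m n N : nat)
    (H : 'M[R]_(m, n) -> 'rV[R]_N) (x : 'M[R]_(m, n)) : 'M[R]_(N, m * n) :=
  ('J (H \o vec_mx) (mxvec x))^T.

Definition jacobian_tr (R : realType) (m n N : nat)
    (H : 'M[R]_(m, n) -> 'rV[R]_N) (x : 'M[R]_(m, n)) (s : 'rV[R]_N) :
    'M[R]_(m, n) :=
  vec_mx ((jacobian_mx H x)^T *m s^T)^T.

(* The pairs i < j in lexicographic order. *)
Definition lt_pairs (n : nat) : seq ('I_n * 'I_n) :=
  [seq ij : 'I_n * 'I_n <- [seq (i, j) | i <- enum 'I_n, j <- enum 'I_n] | (ij.1 < ij.2)%N].

Lemma size_lt_pairs (n : nat) : size (lt_pairs n) == (n.-1 * n)./2.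
Proof.
apply/eqP; rewrite mulnC -bin2 -bin2_sum size_filter.
rewrite -sum1_count big_mkcond /= big_allpairs_dep /=.
rewrite exchange_big /= big_enum /= big_mkord; apply: eq_bigr => j _.
rewrite big_enum /= -big_mkcond /=.
by rewrite -(big_ord_widen n (fun=> 1%N) (ltnW (ltn_ord j))) sum1_card card_ord.
Qed.

Definition lt_pair (n : nat) (k : 'I_(n.-1 * n)./2) : 'I_n * 'I_n :=
  tnth (Tuple (size_lt_pairs n)) k.

(* Only the values a i j with i < j are used. *)
Definition HFM (R : realType) (d d0 : nat) (a : 'I_d0 -> 'I_d0 -> R)
    (P : 'M[R]_(d, d0)) : 'rV[R]_((d0.-1 * d0)./2) :=
  \row_k (let: (i, j) := lt_pair k in
          a i j * ((col i P)^T *m col j P) ord0 ord0).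

(* Main.v *)
(** The map H = HFM is open at every point P: adding to the columns of P small
    vectors orthogonal to the column space of P changes the pairwise inner
    products by an arbitrary small amount; d0 - 1 orthogonal directions suffice
    because the squared norms are not prescribed, and they exist when
    2 d0 - 1 <= d. Openness lifts points of differentiability of l near H P to
    points near P, which gives one inclusion.

    For the other one, the hull of the limiting gradients of l is compact
    (Caratheodory), so by separation it is enough to bound the derivative of
    l o H at a nearby point, in a direction v, by <t, dH v> for some limiting
    gradient t of l. As H is smooth and l Lipschitz, that derivative is nearly a
    difference quotient of l along dH v, hence is exceeded up to epsilon by the
    derivative of l along dH v at a nearby point of differentiability. This mean
    value inequality follows from Rademacher's theorem and Fubini: on almost every
    line of a fixed direction, l is differentiable at almost every point. *)

Require Import Defs.
From HB Require Import structures.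
From mathcomp Require Import all_boot all_order all_algebra.
From mathcomp Require Import all_classical all_reals all_analysis.
From mathcomp Require Import measurable_realfun.
From mathcomp Require Import ring lra.
Set Implicit Arguments.
Unset Strict Implicit.
Unset Printing Implicit Defensive.
Import Order.TTheory GRing.Theory Num.Theory.
Import numFieldNormedType.Exports.
Local Open Scope classical_set_scope.
Local Open Scope ring_scope.

(** * Lipschitz functions of one real variable *)

(** Two degeneracies shape the argument. The differential of [HFM] need not have full rank (it
    vanishes at 0), so openness cannot come from the implicit function theorem; the quadratic
    equations are solved explicitly. And [l \o HFM a] can be differentiable at [y] while [l] is not
    at [HFM a y]: at 0 this composite is differentiable for every locally Lipschitz [l]. So
    gradients of the composite are not compared with gradients of [l] at the same point, but with
    difference quotients. In several variables, Lebesgue measure is replaced by an abstract product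
    measure whose null sets are translation invariant. Fubini enters in one pattern: a Borel set
    negligible on all lines of one direction has null slices, and is then negligible on almost every
    line of any other direction, provided both directions leave the hyperplane of first coordinate
    0. Linearity of the directional derivative needs no integration against test functions: the
    points of non-additivity are covered by countably many Borel sets that meet each line of a
    suitable direction in separated points. *)

Lemma null_of_interval_le (R : realType)
    (nu : {measure set (measurableTypeR R) -> \bar R}) (C : R) :
  0 <= C ->
  (forall a b : R, a < b -> (nu `]a, b]%classic <= (C * (b - a))%:E)%E) ->
  nu `<< (@lebesgue_measure R).
Proof.
move=> C0 nuC; apply/null_content_dominatesP => A mA A0.
have C1 : 0 < C + 1 by rewrite ltr_wpDl.
apply/eqP; rewrite eq_le measure_ge0 andbT; apply/lee_addgt0Pr => e e0.
rewrite add0e.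
(* A null set has a cover by half-open intervals of total length below [e / (C + 1)], whose
   [nu]-measures add up to at most [e]; the [+ 1] covers [C = 0]. *)
have eC : 0 < e / (C + 1) by rewrite divr_gt0.
have mF : (@wlength R idfun)^*%mu A \is a fin_num.
  by rewrite [X in X \is a fin_num](_ : _ = 0%E); last exact: A0.
have [x [F [mFk AF] <-] Fe] := lb_ereal_inf_adherent eC mF.
move: Fe; rewrite [X in (_ < X + _)%E](_ : _ = 0%E); last exact: A0.
rewrite add0e => Fe.
have mFk' k : measurable (F k : set (measurableTypeR R)).
  have := mFk k; case=> -[a b] _ <-; exact: measurable_itv.
have := measure_sigma_subadditive nu mFk' mA AF.
move=> /le_trans; apply.
apply: (@le_trans _ _ (\sum_(0 <= k <oo) (C%:E * @wlength R idfun (F k)))%E).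
  apply: lee_nneseries => [k _ _|k _]; first exact: measure_ge0.
  have /ocitvP[->|[[a b] /= ab ->]] := mFk k.
    by rewrite measure0 wlength0 mule0.
  by rewrite wlength_itv_bnd ?(ltW ab)// -EFinM; apply: nuC.
rewrite nneseriesZl; last by move=> k _; exact: measure_ge0.
apply: (@le_trans _ _ (C%:E * (e / (C + 1))%:E)%E).
  by apply: lee_wpmul2l; rewrite ?lee_fin// ltW.
rewrite -EFinM lee_fin mulrCA ler_piMr ?(ltW e0)//.
by rewrite ler_pdivrMr// mul1r lerDl.
Qed.

Lemma lipschitz_continuous (R : realType) (V W : normedModType R) (g : V -> W) (K : R) :
  (forall x y, `|g x - g y| <= K * `|x - y|) -> continuous g.
Proof.
move=> gK x; apply/cvgrPdist_le => e e0.
have K0 : 0 < `|K| + 1 by rewrite ltr_wpDl.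
near=> y; apply: (le_trans (gK _ _)).
apply: (@le_trans _ _ ((`|K| + 1) * `|x - y|)).
  by rewrite ler_wpM2r// (le_trans (ler_norm _))// lerDl.
rewrite -ler_pdivlMl//; near: y.
by apply: cvgr_dist_le => //; rewrite mulr_gt0// invr_gt0.
Unshelve. all: by end_near. Qed.

Section lipschitz_real.
Context (R : realType) (g : R -> R) (K : R).
Hypothesis gK : forall x y, `|g x - g y| <= K * `|x - y|.
(** Adding [K * x] makes [g] monotone, so that it has a Stieltjes measure; [F] stays Lipschitz, so
    that measure is absolutely continuous. *)
Let F x := g x + K * x.

Let F_nd : nondecreasing F.
Proof.
move=> x y xy; have := gK x y; rewrite ler_norml => /andP[_].
by rewrite distrC ger0_norm ?subr_ge0// /F mulrBr => h; lra.
Qed.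

Let F_lip a b : a <= b -> F b - F a <= 2 * K * (b - a).
Proof.
move=> ab; have := gK b a; rewrite ler_norml => /andP[_].
by rewrite ger0_norm ?subr_ge0// /F mulrBr => h; lra.
Qed.

Let F_rc : right_continuous F.
Proof.
apply: right_continuousW => x; apply: cvgD; first exact: (@lipschitz_continuous R R^o R^o g K gK x).
by apply: cvgM; [exact: cvg_cst|exact: cvg_id].
Qed.

Let cF : cumulative R R :=
  HB.pack_for (cumulative R R) F (isCumulative.Build R _ R F F_nd F_rc).

Let nu := lebesgue_stieltjes_measure cF.
Local Notation lam := (@lebesgue_measure R).

Let nu_itv a b : a <= b -> nu `]a, b]%classic = (F b - F a)%:E.
Proof.
move=> ab; rewrite /nu/= /lebesgue_stieltjes_measure/= /measure_extension.
rewrite measurable_mu_extE/=; first by rewrite wlength_itv_bnd.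
exact: is_ocitv.
Qed.

(** [h] is the Radon-Nikodym density of the Stieltjes measure of [F], restricted to []-N, N]] to be
    finite. By Lebesgue differentiation its primitive [G] has derivative [h] almost everywhere, and
    there [G] differs from [F] by a constant. *)
Lemma lipschitz_primitive (N : R) : 0 < N -> exists h : R -> R,
  [/\ forall x, 0 <= h x, lam.-integrable setT (EFin \o h),
      {ae lam, forall x, -N < x < N -> derivable g x 1 /\ 'D_1 g x = h x - K} &
      forall x y, -N <= x -> x <= y -> y <= N ->
       (\int[lam]_(t in `]x, y]) (h t)%:E = (g y - g x + K * (y - x))%:E)%E].
Proof.
move=> N0.
have K0 : 0 <= K by have := gK 1 0; rewrite subr0 normr1 mulr1; apply: le_trans.
pose D : set (measurableTypeR R) := `]-N, N]%classic.
have mD : measurable D by exact: measurable_itv.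
have NN : -N <= N by lra.
have nuD : (nu D < +oo)%E by rewrite nu_itv// ltry.
pose nuN : {finite_measure set (measurableTypeR R) -> \bar R} := mfrestr mD nuD.
have nuNE A : nuN A = nu (A `&` D) by [].
have [p [p0 pfin pint nup]] : exists p : measurableTypeR R -> \bar R,
    [/\ forall x, (0 <= p x)%E, forall x, p x \is a fin_num,
    lam.-integrable setT p &
    forall A, measurable A -> nuN A = (\int[lam]_(x in A) p x)%E].
  apply: radon_nikodym_sigma_finite.
  apply: (null_of_interval_le (C := 2 * K)); first by rewrite mulr_ge0.
  move=> a b ab.
  have /le_trans : (nu (`]a, b]%classic `&` D) <= nu `]a, b]%classic)%E.
    apply: le_measure; rewrite ?inE.
    - by apply: measurableI => //; exact: measurable_itv.
    - exact: measurable_itv.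
    - exact: subIsetl.
  apply; rewrite (nu_itv (ltW ab)). by rewrite lee_fin F_lip// ltW.
pose h x := fine (p x).
have hE : EFin \o h = p by apply/funext => x /=; rewrite fineK.
have hint : lam.-integrable setT (EFin \o h) by rewrite hE.
have hI x y : -N <= x -> x <= y -> y <= N ->
    (\int[lam]_(t in `]x, y]) (h t)%:E = (g y - g x + K * (y - x))%:E)%E.
  move=> Nx xy yN.
  transitivity (\int[lam]_(t in `]x, y]) p t)%E.
    by apply: eq_integral => t _; rewrite /h fineK.
  rewrite -nup; last exact: measurable_itv.
  rewrite nuNE (_ : _ `&` _ = `]x, y]%classic).
    rewrite nu_itv//; congr EFin; rewrite /F; ring.
  apply/seteqP; split=> t; rewrite /D/= !in_itv/=; first by case.
  move=> /andP[xt ty]; rewrite xt ty; split => //.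
  by rewrite (le_lt_trans Nx)//= (le_trans ty).
pose G y := \int[lam]_(t in `]- N, y]) h t.
have key (x : R) : - N < x -> x < N -> derivable G x 1 -> G^`()%classic x = h x ->
    derivable g x 1 /\ 'D_1 g x = h x - K.
  move=> Nx xN dG DG.
  have GE y : -N <= y -> y <= N -> G y = F y - F (- N).
    by move=> Ny yN; rewrite /G /Rintegral hI//= /F; ring.
  have nGE : \forall y \near x, (G - K *: id + cst (F (- N))) y = g y.
    near=> y.
    have Ny : - N <= y by near: y; exact: lt_le_nbhsr.
    have yN : y <= N by near: y; exact: lt_le_nbhsl.
    by rewrite /= !fctE GE// /F /GRing.scale/=; ring.
  have dK : is_derive x 1 (K *: id : R -> R) (K *: 1).
    by apply: is_deriveZ; exact: is_derive_id.
  have dG' : is_derive x (1 : R) G (h x).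
    by split => //; rewrite -DG derive1E.
  have dsum : is_derive x (1:R) (G - K *: id + cst (F (- N))) (h x - K *: 1 + 0).
    by apply: is_deriveD.
  have [dd DD] := dsum.
  split; first by exact: (@near_eq_derivable _ R^o R^o _ _ _ _ nGE dd).
  rewrite -(@near_eq_derive _ R^o R^o _ _ _ _ nGE) DD addr0.
  by congr (_ - _); exact: mulr1.
exists h; split => //; first by move=> x; exact: fine_ge0.
have := @FTC1 R h (BRight (- N)).
case=> // [y||].
- by apply: integrableS hint => //; exact: measurable_itv.
- by apply: open_integrable_locally => //; exact: openT.
move=> Z [mZ Z0 HZ]; exists Z; split => // x /= Hx; apply: HZ => /= H.
apply: Hx => /andP[Nx xN].
have [] := H _; first by rewrite lte_fin.
exact: key.
Unshelve. all: by end_near. Qed.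

End lipschitz_real.

Lemma ae_forall_countable (R : realType) d (T : measurableType d)
    (mu : {measure set T -> \bar R}) (I : countType) (P : I -> T -> Prop) :
  (forall i, {ae mu, forall x, P i x}) -> {ae mu, forall x, forall i, P i x}.
Proof.
move=> aeP.
have : {ae mu, forall x n, if unpickle n is Some i then P i x else True}.
  by apply/ae_foralln => n; case: (unpickle n) => [i|]; [exact: aeP|exact: aeW].
have FF := ae_filter_ringOfSetsType mu; apply: filterS.
by move=> x Px i; have := Px (pickle i); rewrite pickleK.
Qed.

Lemma lipschitz_ae_derivable (R : realType) (g : R -> R) (K : R) :
  (forall x y, `|g x - g y| <= K * `|x - y|) ->
  {ae (@lebesgue_measure R), forall x, derivable g x 1}.
Proof.
move=> gK; have FF := ae_filter_ringOfSetsType (@lebesgue_measure R).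
have : {ae (@lebesgue_measure R), forall x (n : nat),
    - n.+1%:R < x < n.+1%:R -> derivable g x 1}.
  apply/ae_foralln => n.
  have [h [_ _ + _]] := lipschitz_primitive gK (ltr0Sn R n).
  by apply: filterS => x /= H /H[].
apply: filterS => x /= H; apply: (H (Num.bound `|x|)).
by rewrite -ltr_norml (lt_trans (archi_boundP (normr_ge0 x)))// ltr_nat.
Qed.

Lemma lipschitz_le_of_ae_deriv_le (R : realType) (g : R -> R) (K c a b : R) :
  (forall x y, `|g x - g y| <= K * `|x - y|) -> a <= b ->
  {ae (@lebesgue_measure R), forall x, a < x <= b -> 'D_1 g x <= c} ->
  g b - g a <= c * (b - a).
Proof.
move=> gK ab gc.
(* The larger Lipschitz constant makes [c + L] nonnegative, as the comparison of nonnegative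
   integrals requires. *)
pose L := K + `|c|.
have gL x y : `|g x - g y| <= L * `|x - y|.
  by rewrite (le_trans (gK _ _))// ler_wpM2r// lerDl.
have cL : 0 <= c + L.
  have K0 : 0 <= K by have := gK 1 0; rewrite subr0 normr1 mulr1; apply: le_trans.
  by rewrite /L addrCA addr_ge0// -lerBlDl sub0r -normrN ler_norm.
pose N := `|a| + `|b| + 1.
have N0 : 0 < N by rewrite /N ltr_wpDl// addr_ge0.
have [h [h0 hint hD hI]] := lipschitz_primitive gL N0.
have /andP[Na aN] : - N < a < N.
  by rewrite -ltr_norml /N -addrA ltrDl ltr_wpDl.
have /andP[Nb bN] : - N < b < N.
  by rewrite -ltr_norml /N addrAC ltrDr ltr_wpDl.
have := hI _ _ (ltW Na) ab (ltW bN).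
have mI : measurable (`]a, b]%classic : set (measurableTypeR R)).
  exact: measurable_itv.
have : (\int[lebesgue_measure]_(t in `]a, b]) (h t)%:E <= ((c + L) * (b - a))%:E)%E.
  have -> : ((c + L) * (b - a))%:E =
      (\int[lebesgue_measure]_(t in `]a, b]) (cst (c + L)%:E) t)%E.
    have E := @lebesgue_measure_itv R `]a, b].
    rewrite integral_cst// [X in (_ * X)%E]E/= lte_fin.
    case: ltP => [ab'|ba]; first by rewrite -EFinB -EFinM.
    have -> : b = a by apply/eqP; rewrite eq_le ab ba.
    by rewrite subrr mulr0 mule0.
  apply: ae_ge0_le_integral => //.
  - by move=> x _; rewrite lee_fin.
  - apply: (@measurable_funS _ _ _ _ setT) => //.
    exact: (measurable_int (@lebesgue_measure R)).
  - have F := ae_filter_ringOfSetsType (@lebesgue_measure R).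
    move: gc hD; apply: filterS2 => x /= xc xh; rewrite in_itv/= => /andP[ax xb].
    have [|_ hx] := xh; first by rewrite (lt_trans Na)// (le_lt_trans xb).
    by rewrite lee_fin -lerBlDr -hx; apply: xc; rewrite ax.
by move=> + E; rewrite E lee_fin [(c + L) * _]mulrDl lerD2r.
Qed.

(** * Null sets, Fubini and affine images *)

Section null_sets.
Local Open Scope ereal_scope.

Lemma ge0_integral_eq0P (R : realType) d (T : measurableType d)
    (mu : {measure set T -> \bar R}) (f : T -> \bar R) :
  measurable_fun setT f -> (forall x, 0 <= f x) ->
  \int[mu]_x f x = 0 <-> {ae mu, forall x, f x = 0}.
Proof.
move=> mf f0; have FF := ae_filter_ringOfSetsType mu.
have := ae_eq_integral_abs mu measurableT mf.
under eq_integral do rewrite gee0_abs//.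
move=> [H1 H2]; split=> [/H1|H].
  by apply: filterS => x; exact.
by apply: H2; move: H; apply: filterS => x /= ->.
Qed.

Lemma ae_measurableP (R : realType) d (T : measurableType d)
    (mu : {measure set T -> \bar R}) (A : set T) : measurable A ->
  {ae mu, forall x, ~ A x} <-> mu A = 0.
Proof.
move=> mA; rewrite -(negligibleP mu mA) /almost_everywhere/=.
rewrite /prop_near1 /almost_everywhere /nbhs/= /almost_everywhere/=.
by rewrite (_ : ~` _ = A)//; rewrite eqEsubset; split=> x /=; [move/contrapT|move=> ? ?].
Qed.

Section prod.
Context (R : realType) d1 d2 (T1 : measurableType d1) (T2 : measurableType d2).
Context (m1 : {sigma_finite_measure set T1 -> \bar R}).
Context (m2 : {sigma_finite_measure set T2 -> \bar R}).
Variable A : set (T1 * T2).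
Hypothesis mA : measurable A.

Lemma product_measure_eq0P :
  (m1 \x m2) A = 0 <-> {ae m1, forall x, m2 (xsection A x) = 0}.
Proof.
have := @ge0_integral_eq0P _ _ _ m1 (m2 \o xsection A).
by apply; [exact: measurable_fun_xsection|move=> x; exact: measure_ge0].
Qed.

Lemma ae_section_swap : {ae m1, forall x, m2 (xsection A x) = 0} <->
  {ae m2, forall y, m1 (ysection A y) = 0}.
Proof.
have H1 := @ge0_integral_eq0P _ _ _ m1 (m2 \o xsection A)
  (measurable_fun_xsection m2 mA) (fun x => measure_ge0 _ _).
have H2 := @ge0_integral_eq0P _ _ _ m2 (m1 \o ysection A)
  (measurable_fun_ysection m1 mA) (fun x => measure_ge0 _ _).
have := indic_fubini_tonelli m1 m2 mA.
rewrite indic_fubini_tonelli_FE// indic_fubini_tonelli_GE// => E.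
split.
  by move=> /H1; rewrite E => /H2.
by move=> /H2; rewrite -E => /H1.
Qed.

End prod.

(** The preimage of an interval lies in a closed interval [|c|^-1] times as long (min and max treat
    both signs of [c]), so the image of Lebesgue measure is absolutely continuous. *)
Lemma ae_affine (R : realType) (P : R -> Prop) (c b : R) : c != 0%R ->
  {ae (@lebesgue_measure R), forall t, P t} ->
  {ae (@lebesgue_measure R), forall s, P (c * s + b)%R}.
Proof.
move=> c0 [N [mN N0 PN]].
have mf : measurable_fun setT (fun s : measurableTypeR R => (c * s + b)%R : measurableTypeR R).
  by apply: measurable_funD => //; apply: measurable_funM.
exists ((fun s => (c * s + b)%R) @^-1` N); split.
- by rewrite -[X in measurable X]setTI; apply: mf.
- pose nu := pushforward (@lebesgue_measure R)
    (fun s : measurableTypeR R => (c * s + b)%R : measurableTypeR R).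
  have : (nu `<< (@lebesgue_measure R)).
    apply: (@null_of_interval_le _ nu `|c|^-1) => //.
    move=> x y xy; rewrite /nu /pushforward/=.
    have sub : ((fun s => (c * s + b)%R) @^-1` `]x, y]%classic) `<=`
       `[(Num.min ((x - b) / c) ((y - b) / c)), (Num.max ((x - b) / c) ((y - b) / c))]%classic%R.
      move=> s /=; rewrite !in_itv/= => /andP[xs sy].
      have [cp|cn] := ltP 0%R c.
        have h1 : ((x - b) / c <= s)%R.
          by rewrite ler_pdivrMr// [(s * c)%R]mulrC lerBlDr ltW.
        have h2 : (s <= (y - b) / c)%R.
          by rewrite ler_pdivlMr// [(s * c)%R]mulrC lerBrDr.
        by rewrite ge_min le_max h1 h2 orbT.
      have {}cn : (c < 0)%R by rewrite lt_neqAle c0 cn.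
      have h1 : (s <= (x - b) / c)%R.
        by rewrite ler_ndivlMr// [(s * c)%R]mulrC lerBlDr ltW.
      have h2 : ((y - b) / c <= s)%R.
        by rewrite ler_ndivrMr// [(s * c)%R]mulrC lerBrDr.
      by rewrite ge_min le_max h1 h2 orbT.
    have /le_trans : (@lebesgue_measure R (((fun s => (c * s + b)%R) @^-1` `]x, y]%classic)) <=
      @lebesgue_measure R
       `[(Num.min ((x - b) / c) ((y - b) / c)), (Num.max ((x - b) / c) ((y - b) / c))]%classic%R)%E.
      apply: (@le_measure _ _ _ (@lebesgue_measure R)); rewrite ?inE.
      - rewrite -[X in measurable X]setTI; apply: mf => //; exact: measurable_itv.
      - exact: measurable_itv.
      - exact: sub.
    apply.
    rewrite lebesgue_measure_itv/= lte_fin; case: ifPn => _; last first.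
        by rewrite lee_fin mulr_ge0// subr_ge0 ltW.
      rewrite -EFinB lee_fin.
      have -> : (`|c|^-1 * (y - x) = `|(y - b) / c - (x - b) / c|)%R.
        rewrite -mulrBl normrM normfV mulrC; congr (_ * _)%R.
        by rewrite opprB addrA subrK gtr0_norm// subr_gt0.
      by case: (ltP ((x - b) / c) ((y - b) / c))%R => h; [rewrite ler_norm|rewrite distrC ler_norm].
  by move/null_content_dominatesP; apply.
- by move=> s /= Ps; apply: PN => /=.
Qed.

End null_sets.

(** * Borel sets of matrices *)

Section matrix_norm.
Context (R : realType) (m n : nat).
Implicit Types x y : 'M[R]_(m, n).

Lemma ler_entry_norm x i j : `|x i j| <= `|x|.
Proof.
rewrite [X in _ <= X]/Num.norm/= mx_normrE.
by have := @le_bigmax _ R _ 0 (fun ij : 'I_m * 'I_n => `|x ij.1 ij.2|) (i, j).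
Qed.

Lemma mx_norm_le x (e : R) : 0 <= e -> (forall i j, `|x i j| <= e) -> `|x| <= e.
Proof.
move=> e0 H; rewrite [X in X <= _]/Num.norm/= mx_normrE.
by apply: bigmax_le => // -[i j] _; exact: H.
Qed.

Lemma mx_norm_ltP x (e : R) : 0 < e -> `|x| < e <-> forall i j, `|x i j| < e.
Proof.
move=> e0; split=> [H i j|H]; first by rewrite (le_lt_trans _ H)// ler_entry_norm.
rewrite [X in X < _]/Num.norm/= mx_normrE.
by apply: bigmax_lt => // -[i j] _; exact: H.
Qed.

(** Zero entries are avoided so that the approximants, as directions, leave the hyperplane of first
    coordinate 0. *)
Lemma rat_mx_dense x (e : R) : 0 < e ->
  exists q : 'M[rat]_(m, n), `|x - map_mx ratr q| < e /\ forall i j, q i j != 0.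
Proof.
move=> e0.
have H i j : exists r : rat, `|x i j - ratr r| < e /\ r != 0.
  have [x0|x0] := leP 0 (x i j).
    have [r] := @rat_in_itvoo R (x i j) (x i j + e) (ltr_pwDr e0 (lexx _)).
    rewrite in_itv/= => /andP[h1 h2]; exists r; split.
      by rewrite distrC gtr0_norm ?subr_gt0// ltrBlDl.
    by rewrite -(fmorph_eq0 (ratr : rat -> R)) gt_eqF// (le_lt_trans x0).
  have [|r] := @rat_in_itvoo R (x i j - e) (x i j); first by rewrite ltrBlDr ltrDl.
  rewrite in_itv/= => /andP[h1 h2]; exists r; split.
    by rewrite gtr0_norm ?subr_gt0// ltrBlDl addrC -ltrBlDl.
  by rewrite -(fmorph_eq0 (ratr : rat -> R)) lt_eqF// (lt_trans h2).
exists (\matrix_(i, j) projT1 (cid (H i j))); split.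
  apply/mx_norm_ltP => // i j; rewrite !mxE; by case: cid => r [].
by move=> i j; rewrite mxE; by case: cid => r [].
Qed.

Lemma ball_mxE x (e : R) : ball x e = [set y | `|x - y| < e].
Proof. by rewrite -ball_normE. Qed.

Definition borel (B : set 'M[R]_(m, n)) := <<s (@open 'M[R]_(m, n)) >> B.

Lemma open_bigcup_rat_ball (U : set 'M[R]_(m, n)) : open U ->
  U = \bigcup_(qk in [set qk : 'M[rat]_(m, n) * nat |
        ball (map_mx ratr qk.1 : 'M[R]_(m, n)) qk.2.+1%:R^-1 `<=` U])
      ball (map_mx ratr qk.1 : 'M[R]_(m, n)) qk.2.+1%:R^-1.
Proof.
move=> oU; apply/seteqP; split=> [x Ux|x [qk /= H]]; last exact: H.
have /nbhs_ballP[e /= e0 eU] : nbhs x U by exact: open_nbhs_nbhs.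
have e2 : 0 < e / 2 by rewrite divr_gt0.
have [k] : exists k : nat, k.+1%:R^-1 < e / 2.
  have [k _ kE] := near_infty_natSinv_lt (PosNum e2).
  by exists k; apply: kE => /=.
have k0 : 0 < k.+1%:R^-1 :> R by rewrite invr_gt0.
move=> ke; have [q [xq _]] := rat_mx_dense x k0.
exists (q, k) => /=.
  move=> y; rewrite ball_mxE/= => qy; apply: eU; rewrite ball_mxE/=.
  rewrite (le_lt_trans (ler_distD (map_mx ratr q : 'M[R]_(m, n)) _ _))// [ltRHS]splitr ltrD//.
    exact: lt_trans xq ke.
  exact: lt_trans qy ke.
by rewrite ball_mxE/= distrC.
Qed.

(** An open set is a countable union of balls with rational centres, and a ball of the maximum norm
    is a finite intersection of conditions on single entries. *)
Lemma borel_preimage d (T : measurableType d) (phi : T -> 'M[R]_(m, n)) B :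
  (forall i j, measurable_fun setT (fun t => phi t i j)) -> borel B ->
  measurable (phi @^-1` B).
Proof.
move=> mphi mB.
have : measurable_fun setT (phi : T -> g_sigma_algebraType (@open 'M[R]_(m, n))).
  apply: (@measurability _ _ T (g_sigma_algebraType (@open 'M[R]_(m, n))) setT phi (@open 'M[R]_(m, n)))
    => // _ [U oU <-]; rewrite setTI.
  rewrite (open_bigcup_rat_ball oU) preimage_bigcup bigcup_mkcond.
  apply: countable_bigcupT_measurable => [|[q k]]; first exact: countableP.
  case: ifPn => [_|_]; last exact: measurable0.
  rewrite [X in measurable X](_ : _ = \big[setI/setT]_i \big[setI/setT]_j
      (fun t => phi t i j) @^-1` [set y | `|ratr (q i j) - y| < k.+1%:R^-1]).
    apply: bigsetI_measurable => i _; apply: bigsetI_measurable => j _.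
    rewrite -[X in measurable X]setTI; apply: mphi => //.
    apply: open_measurable; have := @ball_open R R^o (ratr (q i j)) k.+1%:R^-1.
    by rewrite -ball_normE; apply; rewrite invr_gt0.
  have k0 : 0 < k.+1%:R^-1 :> R by rewrite invr_gt0.
  apply/seteqP; split => t.
    rewrite /preimage ball_mxE/= => /(mx_norm_ltP _ k0) H.
    rewrite -bigcap_seq => i _; rewrite -bigcap_seq => j _ /=.
    by have := H i j; rewrite !mxE.
  rewrite -bigcap_seq => H; rewrite /preimage ball_mxE/=.
  apply/(mx_norm_ltP _ k0) => i j; have := H i; rewrite /= mem_index_enum => /(_ isT).
  rewrite -bigcap_seq => /(_ j); rewrite /= mem_index_enum => /(_ isT).
  by rewrite !mxE.
by move=> /(_ measurableT B mB); rewrite setTI.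
Qed.

End matrix_norm.

(** * A quasi-invariant measure on row vectors *)

Section line_coordinates.
Context (R : realType) (n : nat).

Definition rv_cons (t : R) (x : 'rV[R]_n) : 'rV[R]_(1 + n) := row_mx t%:M x.

Lemma rv_cons0 t x : rv_cons t x 0 0 = t.
Proof.
transitivity (rv_cons t x 0 (lshift n 0)); last by rewrite row_mxEl mxE.
by congr (rv_cons t x _ _); exact: val_inj.
Qed.

Lemma rv_consD t x s y : rv_cons t x + rv_cons s y = rv_cons (t + s) (x + y).
Proof. by rewrite /rv_cons add_row_mx raddfD. Qed.

Lemma rv_consZ c t x : c *: rv_cons t x = rv_cons (c * t) (c *: x).
Proof. by rewrite /rv_cons scale_row_mx -scalemx1 scalerA scalemx1. Qed.

Lemma rv_cons_surj (v : 'rV[R]_(1 + n)) : v = rv_cons (v 0 0) (rsubmx v).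
Proof.
rewrite -{1}[v]hsubmxK /rv_cons; congr row_mx; apply/rowP => i.
by rewrite !ord1 !mxE eqxx mulr1n; congr (v _ _); apply: val_inj.
Qed.

Lemma norm_rv_cons t x : `|rv_cons t x| = Num.max `|t| `|x|.
Proof.
apply/eqP; rewrite eq_le; apply/andP; split.
  apply: mx_norm_le; first by rewrite le_max normr_ge0.
  move=> i j; rewrite /rv_cons mxE le_max; case: fintype.split => k.
    by rewrite !ord1 mxE eqxx mulr1n lexx.
  by rewrite ler_entry_norm orbT.
rewrite ge_max -{1}(rv_cons0 t x) ler_entry_norm/=.
apply: mx_norm_le => // i j.
by rewrite !ord1 -(row_mxEr t%:M x) ler_entry_norm.
Qed.

Lemma measurable_rv_cons d (T : measurableType d) (f : T -> R) (g : T -> 'rV[R]_n) :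
  measurable_fun setT f -> (forall i j, measurable_fun setT (fun t => g t i j)) ->
  forall i j, measurable_fun setT (fun t => rv_cons (f t) (g t) i j).
Proof.
move=> mf mg i j; rewrite /rv_cons.
under eq_fun do rewrite mxE.
case: fintype.split => k; last exact: mg.
rewrite !ord1.
by under eq_fun do rewrite mxE eqxx mulr1n.
Qed.

End line_coordinates.

Section sigma_finite_product.
Local Open Scope ereal_scope.
Context (R : realType) d1 d2 (T1 : measurableType d1) (T2 : measurableType d2).
Variables (m1 : {sigma_finite_measure set T1 -> \bar R}).
Variables (m2 : {sigma_finite_measure set T2 -> \bar R}).

(* The library's sigma-finite instance on [m1 \x m2] is shadowed by the one for
   subprobabilities, hence this alias. *)
Definition sf_product : set (T1 * T2) -> \bar R := m1 \x m2.

HB.instance Definition _ := Measure.on sf_product.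

Lemma sf_product_sigma_finite : sigma_finite setT sf_product.
Proof.
have /sigma_finiteP[F [TF ndF Foo]] := sigma_finiteT m1.
have /sigma_finiteP[G [TG ndG Goo]] := sigma_finiteT m2.
exists (fun n => F n `*` G n) => [|k].
  apply/esym/seteqP; split=> // -[x y] _.
  have [n _ Fx] : (\bigcup_k F k) x by rewrite -TF.
  have [k _ Gy] : (\bigcup_k G k) y by rewrite -TG.
  exists (maxn n k) => //; split => /=.
    by move: x Fx; exact/subsetPset/ndF/leq_maxl.
  by move: y Gy; exact/subsetPset/ndG/leq_maxr.
have [? ?] := Foo k; have [? ?] := Goo k.
split; first exact: measurableX.
by rewrite /sf_product product_measure1E// lte_mul_pinfty// ge0_fin_numE.
Qed.

HB.instance Definition _ :=
  Measure_isSigmaFinite.Build _ _ _ sf_product sf_product_sigma_finite.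

End sigma_finite_product.

(* Stand-in for Lebesgue measure on R^n: T carries the measure, phi gives the
   coordinates and tau w acts as the translation by w; only the null sets need
   be invariant. *)
Definition quasi_invariant (R : realType) n d (T : measurableType d)
    (mu : {sigma_finite_measure set T -> \bar R}) (phi : T -> 'rV[R]_n)
    (tau : 'rV[R]_n -> T -> T) :=
  [/\ forall i j, measurable_fun setT (fun x => phi x i j),
      forall w, measurable_fun setT (tau w),
      forall w x, phi (tau w x) = phi x + w,
      forall w A, measurable A -> mu A = 0%E -> mu (tau w @^-1` A) = 0%E &
      forall r, 0 < r -> mu (phi @^-1` ball 0 r) != 0%E].

(** Each induction step multiplies by Lebesgue measure on a new first coordinate, starting from a
    point mass. A null set of the product has almost all sections null, so translations are handled
    factor by factor; balls of the maximum norm are products. *)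
Lemma exists_quasi_invariant (R : realType) n :
  exists d (T : measurableType d) (mu : {sigma_finite_measure set T -> \bar R})
    (phi : T -> 'rV[R]_n) (tau : 'rV[R]_n -> T -> T), quasi_invariant mu phi tau.
Proof.
elim: n => [|n [d [T [mu [phi [tau [mphi mtau phitau munull muball]]]]]]].
  exists _, unit, (dirac tt), (fun=> 0), (fun _ x => x); split => //.
  - by move=> w x; rewrite [w]thinmx0 addr0.
  - move=> r r0.
    pose Z : set unit := (fun=> 0 : 'rV[R]_0) @^-1` ball 0 r.
    have E : (\d_tt Z = 1%E :> \bar R)%E.
      by rewrite diracE mem_set//; exact: ballxx.
    by rewrite [X in X != _](_ : _ = 1%E)// ?oner_neq0.
exists _, (measurableTypeR R * T)%type, (sf_product (@lebesgue_measure R) mu),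
  (fun tx => rv_cons tx.1 (phi tx.2)),
  (fun (w : 'rV[R]_(1 + n)) tx => (tx.1 + w 0 0, tau (rsubmx w) tx.2)).
have mtau' (w : 'rV[R]_(1 + n)) : measurable_fun setT
    (fun tx : measurableTypeR R * T =>
     (tx.1 + w 0 0 : measurableTypeR R, tau (rsubmx w) tx.2)).
  apply: measurable_fun_pair.
    by apply: measurable_funD => //; exact: measurable_fst.
  by apply: measurableT_comp => //; exact: measurable_snd.
split.
- apply: measurable_rv_cons; first exact: measurable_fst.
  by move=> i j; apply: measurableT_comp (mphi i j) _; exact: measurable_snd.
- exact: mtau'.
- by move=> w [t x]/=; rewrite phitau [in RHS](rv_cons_surj w) rv_consD.
- move=> w A mA /product_measure_eq0P-/(_ mA) A0.
  apply/product_measure_eq0P.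
    by rewrite -[X in measurable X]setTI; exact: mtau'.
  have := ae_affine (w 0 0) (oner_neq0 R) A0.
  have FF := ae_filter_ringOfSetsType (@lebesgue_measure R).
  apply: filterS => t; rewrite mul1r => H.
  rewrite [X in mu X](_ : _ = tau (rsubmx (w : 'rV[R]_(1 + n))) @^-1` xsection A (t + w 0 0)).
    by apply: munull => //; exact: measurable_xsection.
  by apply/seteqP; split=> x; rewrite /xsection/= !inE.
- move=> r r0.
  pose Z : set (measurableTypeR R * T) := ball (0 : R) r `*` (phi @^-1` ball 0 r).
  rewrite (_ : _ @^-1` _ = Z).
    suff : sf_product (@lebesgue_measure R) mu Z != 0%E by [].
    rewrite /sf_product /Z product_measure1E//.
    - rewrite mule_neq0 ?muball//.
      have := @lebesgue_measure_ball R 0 r (ltW r0) => E.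
      by rewrite [X in X != _]E eqe mulrn_eq0/= gt_eqF.
    - exact: measurable_ball.
    - by apply: borel_preimage => //; apply: sub_sigma_algebra; exact: ball_open.
  have bR (s : R) : ball (0 : R) r s = (`|s| < r) :> Prop.
    by rewrite -ball_normE /= sub0r normrN.
  have bM k (x : 'rV[R]_k) : ball (0 : 'rV[R]_k) r x = (`|x| < r) :> Prop.
    by rewrite ball_mxE /= sub0r normrN.
  apply/seteqP; split => -[t x]; rewrite /Z /preimage/= bR !bM norm_rv_cons gt_max.
    by move=> /andP[].
  by move=> [-> ->].
Qed.

Section null_slices.
Context (R : realType) (n : nat) d (T : measurableType d).
Variables (mu : {sigma_finite_measure set T -> \bar R}) (phi : T -> 'rV[R]_n).
Variable tau : 'rV[R]_n -> T -> T.
Hypothesis Hq : quasi_invariant mu phi tau.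
Local Notation lam := (@lebesgue_measure R).

(** For Borel [B], nullity for the product of Lebesgue measure and [mu], unfolded by Tonelli. No
    direction occurs in it, so sets found null along different directions can be united. *)
Definition null_slices (B : set 'rV[R]_(1 + n)) :=
  {ae lam, forall t, {ae mu, forall x, ~ B (rv_cons t (phi x))}}.

Lemma null_slices_bigcup (I : countType) (B : I -> set 'rV[R]_(1 + n)) :
  (forall i, null_slices (B i)) -> null_slices (\bigcup_i B i).
Proof.
move=> HB; have FF := ae_filter_ringOfSetsType lam.
have := ae_forall_countable HB; apply: filterS => t Ht.
have FF' := ae_filter_ringOfSetsType mu.
have := ae_forall_countable Ht; apply: filterS => x Hx [i _].
exact: Hx.
Qed.

Lemma null_slicesU B C : null_slices B -> null_slices C -> null_slices (B `|` C).
Proof.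
have FF := ae_filter_ringOfSetsType lam; have FF' := ae_filter_ringOfSetsType mu.
by rewrite /null_slices; apply: filterS2 => t; apply: filterS2 => x HB HC [].
Qed.

Let line_set (B : set 'rV[R]_(1 + n)) (v : 'rV[R]_(1 + n)) : set (measurableTypeR R * T) :=
  [set sx | B (rv_cons 0 (phi sx.2) + sx.1 *: v)].

Let measurable_slice B t : borel B -> measurable [set x | B (rv_cons t (phi x))].
Proof.
case: Hq => mphi _ _ _ _ mB.
apply: (@borel_preimage _ _ _ _ _ (fun x => rv_cons t (phi x)) B _ mB).
by apply: measurable_rv_cons => // i j.
Qed.

(** Moving from the hyperplane of first coordinate 0 by [s *: v] reaches first coordinate
    [s * v 0 0] and translates the rest. *)
Let line_setE v s x : rv_cons 0 (phi x) + s *: v =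
  rv_cons (s * v 0 0) (phi (tau (s *: rsubmx v) x)).
Proof.
case: Hq => _ _ phitau _ _.
by rewrite phitau [in LHS](rv_cons_surj v) rv_consZ rv_consD add0r.
Qed.

Let measurable_line_set B v : borel B -> measurable (line_set B v).
Proof.
case: Hq => mphi _ _ _ _ mB.
apply: (@borel_preimage _ _ _ _ _
  (fun sx : measurableTypeR R * T => rv_cons 0 (phi sx.2) + sx.1 *: v) B _ mB).
move=> i j; under eq_fun do rewrite !mxE.
apply: measurable_funD.
  case: fintype.split => k; first exact: measurable_cst.
  apply: measurableT_comp (mphi i k) _; exact: measurable_snd.
by apply: measurable_funM => //; exact: measurable_fst.
Qed.

Let slice_tau B t w : borel B ->
  mu [set x | B (rv_cons t (phi (tau w x)))] = 0%E <->
  mu [set x | B (rv_cons t (phi x))] = 0%E.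
Proof.
move=> mB; have [mphi mtau phitau munull _] := Hq.
split=> H; last exact: (munull w _ (measurable_slice _ mB) H).
have mS : measurable [set x | B (rv_cons t (phi (tau w x)))].
  have := mtau w measurableT _ (measurable_slice t mB).
  by rewrite setTI.
have := munull (- w) _ mS H; rewrite /preimage/=.
rewrite (_ : [set x | _] = [set x | B (rv_cons t (phi x))])//.
by apply/seteqP; split=> x /=; rewrite !phitau subrK.
Qed.

(** Tonelli turns nullity along lines into nullity, for almost every [s], of the set of base points
    hit; up to translation this is the slice of [B] at [s * v 0 0]. As [v 0 0 != 0], [s] can be
    rescaled to the first coordinate. *)
Lemma null_slices_of_lines B (v : 'rV[R]_(1 + n)) : borel B -> v 0 0 != 0 ->
  (forall x, {ae lam, forall s, ~ B (x + s *: v)}) -> null_slices B.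
Proof.
move=> mB v0 HB; have mL := measurable_line_set v mB.
have FF := ae_filter_ringOfSetsType lam; have FF' := ae_filter_ringOfSetsType mu.
have /(ae_section_swap lam mu mL) : {ae mu, forall x, lam (ysection (line_set B v) x) = 0%E}.
  apply: aeW => x; apply/ae_measurableP; first exact: measurable_ysection.
  have := HB (rv_cons 0 (phi x)); apply: filterS => s.
  by rewrite /ysection/= inE.
have v1 : (v 0 0)^-1 != 0 by rewrite invr_neq0.
move=> /(ae_affine 0 v1); apply: filterS => t; rewrite addr0 => Ht.
apply/ae_measurableP; first exact: measurable_slice.
apply/(slice_tau t (((v 0 0)^-1 * t) *: rsubmx v)) => //.
rewrite -[RHS]Ht; congr (mu _); apply/seteqP.
by split=> x; rewrite /xsection/= inE /line_set/= line_setE mulrAC mulVf// mul1r.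
Qed.

(** The converse exchange, for a [v] unrelated to the directions along which [B] was found null:
    nullity passes from one direction to another. *)
Lemma lines_of_null_slices B (v : 'rV[R]_(1 + n)) : borel B -> v 0 0 != 0 ->
  null_slices B ->
  {ae mu, forall x, {ae lam, forall s, ~ B (rv_cons 0 (phi x) + s *: v)}}.
Proof.
move=> mB v0 HB; have mL := measurable_line_set v mB.
have FF := ae_filter_ringOfSetsType lam; have FF' := ae_filter_ringOfSetsType mu.
have /(ae_section_swap lam mu mL) : {ae lam, forall s, mu (xsection (line_set B v) s) = 0%E}.
  have := ae_affine 0 v0 HB; apply: filterS => s; rewrite addr0.
  move/(ae_measurableP mu (measurable_slice _ mB)).
  move/(slice_tau _ (s *: rsubmx v) mB) => <-; congr (mu _); apply/seteqP.
  by split=> x; rewrite /xsection/= inE /line_set/= line_setE mulrC.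
apply: filterS => x.
move/(ae_measurableP lam (measurable_ysection x mL)).
by apply: filterS => s; rewrite /ysection/= inE.
Qed.

End null_slices.

(** * Differentiability from directional derivatives *)

Section differentiability_criterion.
Context (R : realType) (V W : normedModType R).

Lemma differentiable_eps (f : V -> W) (x : V) (L : {linear V -> W}) :
  continuous L ->
  (forall e, 0 < e -> \forall h \near (0 : V), `|f (h + x) - f x - L h| <= e * `|h|) ->
  differentiable f x /\ 'd f x = L :> (V -> W).
Proof.
move=> cL H.
have E : f \o shift x = cst (f x) + L +o_ 0 id.
  apply/eqaddoP => _/posnumP[e].
  have := H _ [gt0 of e%:num]; apply: filterS => h.
  by rewrite !fctE/= opprD addrA.
have D : 'd f x = L :> (V -> W) by exact: diff_unique.
by split=> //; apply/diff_locallyP; rewrite D.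
Qed.

Lemma eps_differentiable (f : V -> W) (x : V) (e : R) :
  differentiable f x -> 0 < e ->
  \forall h \near (0 : V), `|f (h + x) - f x - 'd f x h| <= e * `|h|.
Proof.
move=> /diff_locally /eqaddoP /(_ e) H e0; have := H e0.
by apply: filterS => h; rewrite !fctE/= opprD addrA.
Qed.

End differentiability_criterion.

Section directional.
Context (R : realType) (m : nat) (l : 'rV[R]_m -> R) (K : R).
Hypothesis lK : forall x y, `|l x - l y| <= K * `|x - y|.
Implicit Types (x v : 'rV[R]_m) (s t : R).

Definition dquot v x s := s^-1 * (l (x + s *: v) - l x).

Let K0 : 0 <= `|K|. Proof. exact: normr_ge0. Qed.

(** In dimension 0 the hypothesis also holds for negative [K], hence the absolute value. *)
Let lK' x y : `|l x - l y| <= `|K| * `|x - y|.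
Proof. by rewrite (le_trans (lK _ _))// ler_wpM2r// ler_norm. Qed.

Lemma dquot_dir_le v w x s : `|dquot v x s - dquot w x s| <= `|K| * `|v - w|.
Proof.
have [->|s0] := eqVneq s 0.
  by rewrite /dquot invr0 !mul0r subrr normr0 mulr_ge0.
rewrite /dquot -mulrBr opprB addrA subrK normrM normfV ler_pdivrMl ?normr_gt0//.
rewrite (le_trans (lK' _ _))// opprD addrACA subrr add0r -scalerBr normrZ.
by rewrite mulrCA.
Qed.

(** The Cauchy criterion avoids the value of the limit: it gives a Borel description of the points
    of derivability and survives a small change of direction. *)
Lemma derivable_dquotP v x : derivable l x v <->
  forall e, 0 < e -> exists2 d, 0 < d &
    forall s t, 0 < `|s| < d -> 0 < `|t| < d -> `|dquot v x s - dquot v x t| <= e.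
Proof.
have E : (fun h => h^-1 *: ((l \o shift x) (h *: v) - l x)) = dquot v x.
  by apply/funext => h; rewrite /dquot/= [x + _]addrC.
rewrite /derivable E; split.
  move=> /cvg_ex[L HL] e e0.
  have e2 : 0 < e / 2 by rewrite divr_gt0.
  have /cvgrPdist_le/(_ _ e2) := HL.
  rewrite near_withinE => /nbhs_ballP[d /= d0 Hd]; exists d => // s t.
  have H r : 0 < `|r| < d -> `|L - dquot v x r| <= e / 2.
    move=> /andP[r0 rd]; apply: Hd; first by rewrite -ball_normE/= sub0r normrN.
    by rewrite -normr_gt0.
  move=> /H Hs /H Ht; rewrite -[dquot v x s](subrK L) -addrA.
  rewrite (le_trans (ler_normD _ _))// [leRHS]splitr lerD// distrC//.
move=> H; apply: (@cauchy_cvg R^o); apply: cauchy_exP => e e0.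
have e2 : 0 < e / 2 by rewrite divr_gt0.
have [d d0 Hd] := H _ e2; exists (dquot v x (d / 2)).
suff : \forall t \near (0 : R)^', ball (dquot v x (d / 2)) e (dquot v x t) by [].
rewrite near_withinE; apply/nbhs_ballP; exists d => //= t.
rewrite -!ball_normE/= sub0r normrN => td t0.
rewrite (@le_lt_trans _ _ (e / 2))//; last by rewrite ltr_pdivrMr// ltr_pMr// ltr1n.
apply: Hd; last by rewrite normr_gt0 t0.
by rewrite gtr0_norm ?divr_gt0//= ltr_pdivrMr// ltr_pMr// ltr1n.
Qed.

Lemma derive_dquot v x e : derivable l x v -> 0 < e ->
  exists2 d, 0 < d & forall s, 0 < `|s| < d -> `|dquot v x s - 'D_v l x| <= e.
Proof.
have E : (fun h => h^-1 *: ((l \o shift x) (h *: v) - l x)) = dquot v x.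
  by apply/funext => h; rewrite /dquot/= [x + _]addrC.
rewrite /derivable E => HL e0; rewrite /derive E.
have /cvgrPdist_le/(_ _ e0) := HL.
rewrite near_withinE => /nbhs_ballP[d /= d0 Hd]; exists d => // s /andP[s0 sd].
rewrite distrC; apply: Hd; first by rewrite -ball_normE/= sub0r normrN.
by rewrite -normr_gt0.
Qed.

Lemma derivable_dense v x :
  (forall e, 0 < e -> exists2 w, `|v - w| < e & derivable l x w) -> derivable l x v.
Proof.
move=> H; apply/derivable_dquotP => e e0.
have e3 : 0 < e / 3 by rewrite divr_gt0.
have K1 : 0 < `|K| + 1 by rewrite ltr_wpDl.
have [w vw /derivable_dquotP/(_ _ e3)[d d0 Hd]] := H _ (divr_gt0 e3 K1).
have Kvw : `|K| * `|v - w| <= e / 3.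
  rewrite ltr_pdivlMr// mulrC in vw.
  by apply: le_trans (ltW vw); rewrite ler_wpM2r// lerDl.
exists d => // s t Hs Ht; have := Hd _ _ Hs Ht.
have := dquot_dir_le v w x s; have := dquot_dir_le v w x t.
rewrite !ler_norml; move: Kvw.
by move: (`|K| * _) => z; lra.
Qed.

Hypothesis x : 'rV[R]_m.
Hypothesis dx : forall v, derivable l x v.

Let g v := 'D_v l x.

Lemma derive_dir_le v w : `|g v - g w| <= `|K| * `|v - w|.
Proof.
apply/ler_addgt0Pr => e e0; have e2 : 0 < e / 2 by rewrite divr_gt0.
have [d d0 Hd] := derive_dquot (@dx v) e2.
have [d' d'0 Hd'] := derive_dquot (@dx w) e2.
pose s := Num.min d d' / 2.
have s0 : 0 < s by rewrite divr_gt0// lt_min d0.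
have ss : s < Num.min d d' by rewrite ltr_pdivrMr// ltr_pMr ?ltr1n// lt_min d0.
move: ss; rewrite lt_min => /andP[sd sd'].
have := Hd s; rewrite gtr0_norm// s0 sd => /(_ isT).
have := Hd' s; rewrite gtr0_norm// s0 sd' => /(_ isT).
have := dquot_dir_le v w x s; rewrite -!/(g _) !ler_norml.
by move: (`|K| * _) => z; lra.
Qed.

Lemma derive_dirZ c v : g (c *: v) = c * g v.
Proof.
have [->|c0] := eqVneq c 0; first by rewrite scale0r mul0r /g derive0.
apply/eqP; rewrite -subr_eq0 -normr_le0; apply/ler_addgt0Pr => e e0; rewrite add0r.
have e2 : 0 < e / 2 by rewrite divr_gt0.
have c1 : 0 < `|c| by rewrite normr_gt0.
have [d d0 Hd] := derive_dquot (@dx (c *: v)) e2.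
have [d' d'0 Hd'] := derive_dquot (@dx v) (divr_gt0 e2 c1).
pose s := Num.min d (d' / `|c|) / 2.
have m0 : 0 < Num.min d (d' / `|c|) by rewrite lt_min d0 divr_gt0.
have s0 : 0 < s by rewrite divr_gt0.
have ss : s < Num.min d (d' / `|c|) by rewrite ltr_pdivrMr// ltr_pMr ?ltr1n.
move: ss; rewrite lt_min => /andP[sd sd'].
have := Hd s; rewrite gtr0_norm// s0 sd => /(_ isT).
have := Hd' (s * c); rewrite normrM gtr0_norm// mulr_gt0// -ltr_pdivlMr// sd' => /(_ isT).
rewrite ler_pdivlMr// mulrC -normrM mulrBr.
have -> : c * dquot v x (s * c) = dquot (c *: v) x s.
  by rewrite /dquot scalerA invfM mulrA [c * (_ * _)]mulrCA divff// mulr1.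
by rewrite -!/(g _) !ler_norml; lra.
Qed.

(** Linearity in the direction only gives a Gateaux derivative. As quotients and [g] are both
    Lipschitz in the direction, convergence is uniform near each direction, hence on the compact
    unit ball. *)
Lemma differentiable_of_derivable :
  (forall v w, g (v + w) = g v + g w) -> differentiable l x /\ 'd l x = g :> (_ -> _).
Proof.
move=> gD.
have glin : linear (g : 'rV[R]_m -> R^o).
  by move=> c v w; rewrite gD derive_dirZ.
pose G : {linear 'rV[R]_m -> R^o} :=
  HB.pack_for {linear 'rV[R]_m -> R^o} (g : 'rV[R]_m -> R^o) (GRing.isLinear.Build _ _ _ _ _ glin).
apply: (@differentiable_eps R 'rV[R]_m R^o l x G).
  apply: (@lipschitz_continuous R 'rV[R]_m R^o _ `|K|) => v w; exact: derive_dir_le.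
move=> e e0.
have K1 : 0 < 2 * `|K| + 1 by rewrite ltr_wpDl// mulr_ge0.
(* Gives [|K| * e1 <= e / 4], paid twice in passing from [v] to a nearby direction: in the quotient
   and in [g]. The other [e / 2] is the error at [v]. *)
pose e1 := e / (2 * `|K| + 1) / 2.
have e10 : 0 < e1 by rewrite !divr_gt0.
have e2 : 0 < e / 2 by rewrite divr_gt0.
have cB : compact (closed_ball (0 : 'rV[R]_m) 1).
  apply: bounded_closed_compact; last exact: closed_ball_closed.
  exists 1; split => // y y1 v; rewrite closed_ballE// /closed_ball_/= sub0r normrN => h.
  by rewrite (le_trans h)// ltW.
move/compact_near_coveringP : cB.
move=> /(_ R 0^'+ (fun s v => `|dquot v x s - g v| <= e)) /(_ _)[].
- move=> v _.
  have [d d0 Hd] := derive_dquot (@dx v) e2.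
  exists (ball v e1, [set s | 0 < s < d]) => /=.
    split; first exact: nbhsx_ballx.
    near=> s; apply/andP; split; near: s; [exact: nbhs_right_gt|exact: nbhs_right_lt].
  move=> [w s] /= [vw /andP[s0 sd]].
  have := Hd s; rewrite gtr0_norm// s0 sd => /(_ isT).
  have := dquot_dir_le v w x s; have := derive_dir_le v w.
  have : `|K| * `|v - w| <= e / 4.
    move: vw; rewrite ball_mxE/= => vw.
    rewrite (@le_trans _ _ (`|K| * e1))//; first by rewrite ler_wpM2l// ltW.
    have E : e1 * (2 * `|K| + 1) = e / 2.
      by rewrite /e1; field; rewrite gt_eqF.
    lra.
  rewrite -!/(g _) !ler_norml.
  by move: (`|K| * _) => z; lra.
move=> d /= d0 Hd.
apply/nbhs_ballP; exists d => //= h; rewrite ball_mxE/= sub0r normrN => hd.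
have [->|h0] := eqVneq h 0.
  by rewrite add0r subrr sub0r normrN [X in `|X|](_ : _ = 0) ?normr0 ?mulr0//; exact: derive0.
have hn : 0 < `|h| by rewrite normr_gt0.
have := Hd `|h|; rewrite /= sub0r normrN normr_id => /(_ hd hn (`|h|^-1 *: h)).
rewrite closed_ballE// /closed_ball_/= sub0r normrN normrZ normfV normr_id mulVf ?normr_eq0// lexx.
move=> /(_ isT).
rewrite /dquot scalerA divff ?normr_eq0// scale1r derive_dirZ -mulrBr normrM normfV normr_id.
by rewrite ler_pdivrMl// [`|h| * e]mulrC [x + h]addrC.
Unshelve. all: by end_near. Qed.

End directional.

(** * Almost everywhere differentiability of Lipschitz functions *)

Section borel_closure.
Context (R : realType) (m n : nat).
Implicit Types B : nat -> set 'M[R]_(m, n).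

Lemma borel_open (U : set 'M[R]_(m, n)) : open U -> borel U.
Proof. by move=> oU; exact: sub_sigma_algebra. Qed.

Lemma borel_setC (U : set 'M[R]_(m, n)) : borel U -> borel (~` U).
Proof.
exact: (@measurableC _ (g_sigma_algebraType (@open 'M[R]_(m, n)))).
Qed.

Lemma borel_bigcup (I : countType) (B : I -> set 'M[R]_(m, n)) :
  (forall i, borel (B i)) -> borel (\bigcup_i B i).
Proof.
apply: (@countable_bigcupT_measurable _ (g_sigma_algebraType (@open 'M[R]_(m, n)))).
exact: countableP.
Qed.

Lemma borel_bigcap B : (forall i, borel (B i)) -> borel (\bigcap_i B i).
Proof.
exact: (@bigcapT_measurable _ (g_sigma_algebraType (@open 'M[R]_(m, n)))).
Qed.

End borel_closure.

(** Distinct points of [S] lie in distinct cells of a grid of step [d], so [S] is countable. *)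
Lemma separated_null (R : realType) (S : set R) (d : R) : 0 < d ->
  (forall s t, S s -> S t -> s != t -> d <= `|s - t|) ->
  {ae (@lebesgue_measure R), forall s, ~ S s}.
Proof.
move=> d0 sep.
have cS : countable S.
  apply/countable_injP.
  exists (fun s => pickle (Num.floor (s / d))) => s t; rewrite !inE => Ss St.
  move=> /(pcan_inj pickleK) E; apply: contrapT => /eqP st.
  have := sep _ _ Ss St st; apply/negP; rewrite -ltNge.
  have := floor_itv (s / d); have := floor_itv (t / d); rewrite E.
  move: (Num.floor _) => z /andP[h1 h2] /andP[h3 h4].
  rewrite intrD in h2 h4.
  have : `|s / d - t / d| < 1 by rewrite ltr_norml; apply/andP; split; lra.
  by rewrite -mulrBl normrM normfV (gtr0_norm d0) ltr_pdivrMr// mul1r.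
exists S; split.
- exact: countable_measurable.
- exact: countable_lebesgue_measure0.
- by move=> s /= /contrapT.
Qed.

Section bad_sets.
Context (R : realType) (m : nat) (l : 'rV[R]_m -> R) (K : R).
Hypothesis lK : forall x y, `|l x - l y| <= K * `|x - y|.
Implicit Types (x v w : 'rV[R]_m) (s t : R).

(** Negation of the Cauchy criterion. The inner union over real steps is uncountable, but its
    members are open, so the set is Borel. *)
Definition nonderivable_set v : set 'rV[R]_m :=
  \bigcup_(j : nat) \bigcap_(k : nat)
   \bigcup_(st in [set st : R * R | 0 < `|st.1| < k.+1%:R^-1 /\ 0 < `|st.2| < k.+1%:R^-1])
    [set x | j.+1%:R^-1 < `|dquot l v x st.1 - dquot l v x st.2|].

Lemma nonderivable_setP v x : ~ nonderivable_set v x <-> derivable l x v.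
Proof.
split=> [H|/derivable_dquotP H].
  apply/derivable_dquotP => e e0.
  have [j _ /(_ _ (leqnn _)) /= ej] := near_infty_natSinv_lt (PosNum e0).
  have : exists k : nat, forall s t : R, 0 < `|s| < k.+1%:R^-1 -> 0 < `|t| < k.+1%:R^-1 ->
     `|dquot l v x s - dquot l v x t| <= j.+1%:R^-1.
    apply: contrapT => /forallNP Hk; apply: H; exists j => // k _.
    have /existsNP[s /existsNP[t /not_implyP[hs /not_implyP[ht /negP]]]] := Hk k.
    by rewrite -ltNge => h; exists (s, t).
  move=> [k Hk]; exists k.+1%:R^-1 => // s t hs ht.
  by rewrite (le_trans (Hk _ _ hs ht))// ltW.
move=> [j _ Hj].
have j0 : 0 < j.+1%:R^-1 :> R by [].
have [d d0 Hd] := H _ j0.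
have [k _ /(_ _ (leqnn _)) /= kd] := near_infty_natSinv_lt (PosNum d0).
have [[s t] /= [/andP[s0 sk] /andP[t0 tk]]] := Hj k I.
by apply/negP; rewrite -leNgt Hd// ?s0 ?t0/= (lt_trans _ kd).
Qed.

Let incr_lipschitz v s x y :
  `|(l (x + s *: v) - l x) - (l (y + s *: v) - l y)| <= 2 * K * `|x - y|.
Proof.
rewrite opprB [l y - _]addrC addrACA [- l x + _]addrC.
rewrite (le_trans (ler_normD _ _))// -mulrA mulr2n mulrDl mul1r lerD//.
  by rewrite (le_trans (lK _ _))// opprD addrACA subrr addr0.
by rewrite distrC.
Qed.

Let dquot_continuous v s : continuous (fun x => dquot l v x s).
Proof.
apply: (@lipschitz_continuous R 'rV[R]_m R^o _ (`|s^-1| * (2 * K))) => x y.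
by rewrite /dquot -mulrBr normrM -mulrA ler_wpM2l// incr_lipschitz.
Qed.

Lemma borel_nonderivable v : borel (nonderivable_set v).
Proof.
apply: borel_bigcup => j; apply: borel_bigcap => k; apply: borel_open.
apply: bigcup_open => -[s t] _ /=.
apply: (@open_comp _ _ (fun x => `|dquot l v x s - dquot l v x t|) [set y | j.+1%:R^-1 < y]).
  have c1 : continuous (fun x => dquot l v x s - dquot l v x t).
    move=> x; apply: (@continuousB R R^o _ (fun x => dquot l v x s) (fun x => dquot l v x t) x).
      exact: dquot_continuous.
    exact: dquot_continuous.
  by move=> x _; exact: cvg_norm (c1 x).
exact: open_gt.
Qed.

Let line x v := fun s => l (x + s *: v).

Lemma line_lipschitz x v s t : `|line x v s - line x v t| <= `|K| * `|v| * `|s - t|.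
Proof.
rewrite /line (le_trans (lK _ _))// opprD addrACA subrr add0r -scalerBl normrZ.
by rewrite [`|s - t| * _]mulrC mulrA ler_wpM2r// ler_wpM2r// ler_norm.
Qed.

Let line_quot x v s :
  (fun h => h^-1 *: ((line x v \o shift s) (h *: 1) - line x v s)) =
  (fun h => h^-1 *: ((l \o shift (x + s *: v)) (h *: v) - l (x + s *: v))).
Proof.
apply/funext => h; rewrite /line/=; congr (_ *: (l _ - _)).
by rewrite [_%:A]mulr1 scalerDl addrCA.
Qed.

Lemma line_derivable x v s : derivable (line x v) s 1 -> derivable l (x + s *: v) v.
Proof. by rewrite /derivable line_quot. Qed.

Lemma line_derive x v s : 'D_1 (line x v) s = 'D_v l (x + s *: v).
Proof. by rewrite /derive line_quot. Qed.

Lemma nonderivable_null_lines v x :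
  {ae (@lebesgue_measure R), forall s, ~ nonderivable_set v (x + s *: v)}.
Proof.
have := lipschitz_ae_derivable (line_lipschitz x v).
have FF := ae_filter_ringOfSetsType (@lebesgue_measure R).
by apply: filterS => s /line_derivable /nonderivable_setP.
Qed.

Definition affine_near (v : 'rV[R]_m) (a e d : R) : set 'rV[R]_m :=
  [set x | forall s, `|s| < d -> `|l (x + s *: v) - l x - s * a| <= e * `|s|].

(** [a], [b], [c] approximate the derivatives along [v], [w], [v + w] with error [e] each; three
    such errors cannot absorb the gap [a + b - c]. Countably many values of the parameters will
    suffice. *)
Definition nonadditive_set v w a b c e d : set 'rV[R]_m :=
  [set x | [/\ 3 * e < `|a + b - c|, affine_near v a e d x,
    affine_near w b e d x & affine_near (v + w) c e d x]].

Lemma closed_affine_near v a e d : closed (affine_near v a e d).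
Proof.
rewrite /affine_near (_ : [set x | _] =
   \bigcap_(s in [set s | `|s| < d]) [set x | `|l (x + s *: v) - l x - s * a| <= e * `|s|]).
  apply: closed_bigI => s _.
  have c1 : continuous (fun x => l (x + s *: v) - l x - s * a).
    apply: (@lipschitz_continuous R 'rV[R]_m R^o _ (2 * K)) => x y.
    by rewrite opprB addrA subrK incr_lipschitz.
  apply: (@closed_comp _ _ (fun x => `|l (x + s *: v) - l x - s * a|) [set y | y <= e * `|s|]).
    by move=> x _; exact: cvg_norm (c1 x).
  exact: closed_le.
by apply/seteqP; split=> x H s; exact: H.
Qed.

Lemma borel_nonadditive v w a b c e d : borel (nonadditive_set v w a b c e d).
Proof.
rewrite -[X in borel X]setCK; apply: borel_setC; apply: borel_open.
rewrite openC.
have [h|h] := boolP (3 * e < `|a + b - c|); last first.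
  rewrite (_ : nonadditive_set _ _ _ _ _ _ _ = set0); first exact: closed0.
  by apply/seteqP; split => // x [h']; rewrite h' in h.
rewrite (_ : nonadditive_set _ _ _ _ _ _ _ =
  affine_near v a e d `&` affine_near w b e d `&` affine_near (v + w) c e d).
  by apply: closedI; [apply: closedI|]; exact: closed_affine_near.
apply/seteqP; split=> x; first by case=> _ ? ? ?; split.
by move=> [[? ?] ?]; split.
Qed.

(* Two points of the set on a line of direction v cannot be closer than d: the
   increment of l along s *: (v + w) from the first one would be both
   s * c and, by passing through the second one, s * (a + b). *)
Lemma nonadditive_null_lines v w a b c e d x : 0 < d ->
  {ae (@lebesgue_measure R), forall s, ~ nonadditive_set v w a b c e d (x + s *: v)}.
Proof.
move=> d0; apply: (@separated_null _ [set s | nonadditive_set v w a b c e d (x + s *: v)] d d0).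
move=> s t [h sv _ sc] [_ _ tw _] st; rewrite leNgt; apply/negP => std.
have r0 : 0 < `|t - s| by rewrite normr_gt0 subr_eq0 eq_sym.
rewrite distrC in std.
have := sv _ std; have := sc _ std; have := tw _ std.
have E1 : x + s *: v + (t - s) *: v = x + t *: v.
  by rewrite -addrA -scalerDl subrKC.
rewrite [(t - s) *: (v + w)]scalerDr [x + s *: v + (_ + _)]addrA !E1.
set A := l (x + t *: v); set B := l (x + s *: v); set C := l (_ + _ + _).
move=> H1 H2 H3.
have : `|(t - s) * (a + b - c)| <= 3 * e * `|t - s|.
  move: H1 H2 H3; rewrite !ler_norml; lra.
by rewrite normrM mulrC ler_pM2r// leNgt h.
Qed.

End bad_sets.

Lemma rat_near (R : realType) (a e : R) : 0 < e -> exists q : rat, `|a - ratr q| < e.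
Proof.
move=> e0; have [q] := @rat_in_itvoo R a (a + e) (ltr_pwDr e0 (lexx _)).
rewrite in_itv/= => /andP[h1 h2]; exists q.
by rewrite distrC gtr0_norm ?subr_gt0// ltrBlDl.
Qed.

Lemma norm_diff_le (R : realType) m (l : 'rV[R]_m -> R) (K : R) x v :
  (forall x y, `|l x - l y| <= K * `|x - y|) -> differentiable l x ->
  `|'d l x v| <= `|K| * `|v|.
Proof.
move=> lK dl.
have := @derive_dir_le R m l K lK x (fun v => diff_derivable dl) v 0.
by rewrite !deriveE// linear0 !subr0.
Qed.

Section almost_everywhere_differentiable.
Context (R : realType) (n : nat) (l : 'rV[R]_(1 + n) -> R) (K : R).
Hypothesis lK : forall x y, `|l x - l y| <= K * `|x - y|.

Let rmx (v : 'rV[rat]_(1 + n)) : 'rV[R]_(1 + n) := map_mx ratr v.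

Let bad1 (v : 'rV[rat]_(1 + n)) : set 'rV[R]_(1 + n) :=
  if v 0 0 != 0 then nonderivable_set l (rmx v) else set0.

Let bad2 (p : 'rV[rat]_(1 + n) * 'rV[rat]_(1 + n) * (rat * rat * rat) * (nat * nat)) :
    set 'rV[R]_(1 + n) :=
  let: (v, w, (a, b, c), (j, k)) := p in
  if v 0 0 != 0 then
    nonadditive_set l (rmx v) (rmx w) (ratr a) (ratr b) (ratr c) j.+1%:R^-1 k.+1%:R^-1
  else set0.

(** A countable union, over rational data. The lines used run along [v], so it is [v] whose first
    coordinate must not vanish; [w] is arbitrary. *)
Definition rademacher_bad := \bigcup_v bad1 v `|` \bigcup_p bad2 p.

Let borel0 : borel (set0 : set 'rV[R]_(1 + n)).
Proof. by apply: borel_open; exact: open0. Qed.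

Lemma borel_rademacher_bad : borel rademacher_bad.
Proof.
apply: (@measurableU _ (g_sigma_algebraType (@open 'rV[R]_(1 + n)))).
  apply: borel_bigcup => v; rewrite /bad1; case: ifP => // _.
  exact: borel_nonderivable lK _.
apply: borel_bigcup => -[[[v w] [[a b] c]] [j k]]; rewrite /bad2; case: ifP => // _.
exact: borel_nonadditive lK _ _ _ _ _ _ _.
Qed.

Lemma null_slices_rademacher_bad d (T : measurableType d)
    (mu : {sigma_finite_measure set T -> \bar R}) phi tau :
  quasi_invariant mu phi tau -> null_slices mu phi rademacher_bad.
Proof.
move=> Hq.
have rmx0 (v : 'rV[rat]_(1 + n)) : v 0 0 != 0 -> rmx v 0 0 != 0.
  by rewrite mxE fmorph_eq0.
have null0 : null_slices mu phi set0.
  by apply: aeW => t; apply: aeW => x [].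
apply: null_slicesU; apply: null_slices_bigcup.
  move=> v; rewrite /bad1; case: ifPn => // /rmx0 v0.
  apply: (null_slices_of_lines Hq _ v0) => [|x]; first exact: borel_nonderivable lK _.
  exact: nonderivable_null_lines lK _ _.
move=> -[[[v w] [[a b] c]] [j k]]; rewrite /bad2; case: ifPn => // /rmx0 v0.
apply: (null_slices_of_lines Hq _ v0) => [|x].
  exact: borel_nonadditive lK _ _ _ _ _ _ _.
by apply: nonadditive_null_lines; rewrite invr_gt0.
Qed.

Lemma differentiable_not_bad x : ~ rademacher_bad x -> differentiable l x.
Proof.
move=> Hx.
have rdense (v : 'rV[R]_(1 + n)) e : 0 < e ->
    exists2 q : 'rV[rat]_(1 + n), `|v - rmx q| < e & q 0 0 != 0.
  by move=> /(rat_mx_dense v)[q [vq q0]]; exists q.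
have dx v : derivable l x v.
  apply: (derivable_dense lK) => e /(rdense v)[q vq q0]; exists (rmx q) => //.
  apply/(nonderivable_setP l) => H; apply: Hx; left; exists q => //.
  by rewrite /bad1 q0.
have add_rat (v w : 'rV[rat]_(1 + n)) : v 0 0 != 0 ->
    'D_(rmx v + rmx w) l x = 'D_(rmx v) l x + 'D_(rmx w) l x.
  move=> v0; apply: contrapT.
  set A := 'D_(rmx v) l x; set B := 'D_(rmx w) l x; set C := 'D_(rmx v + rmx w) l x.
  move=> /eqP ne; apply: Hx; right.
  have ABC : 0 < `|A + B - C| by rewrite normr_gt0 subr_eq0 eq_sym.
  (* Rounding [A], [B], [C] to rationals within [e / 2] moves the gap by at most [3 * e / 2], so a
     gap above [8 * e] stays above the [3 * e] of [nonadditive_set]. *)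
  have e0 : 0 < `|A + B - C| / 8 by rewrite divr_gt0.
  have [j _ /(_ _ (leqnn _)) /= je] := near_infty_natSinv_lt (PosNum e0).
  set e := j.+1%:R^-1 in je; have ep : 0 < e by rewrite invr_gt0.
  have e2 : 0 < e / 2 by rewrite divr_gt0.
  have [a aA] := rat_near A e2; have [b bB] := rat_near B e2.
  have [c cC] := rat_near C e2.
  have near_affine u (D r : R) : 'D_u l x = D -> `|D - r| < e / 2 ->
      exists2 d, 0 < d & affine_near l u r e d x.
    move=> uD Dr; have [d d0 Hd] := derive_dquot (@dx u) e2; exists d => // s sd.
    have [->|s0] := eqVneq s 0; first by rewrite scale0r addr0 subrr mul0r subrr normr0 mulr0.
    have s1 : 0 < `|s| by rewrite normr_gt0.
    have := Hd s; rewrite s1 sd => /(_ isT) H.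
    have -> : l (x + s *: u) - l x - s * r = (dquot l u x s - r) * s.
      by rewrite /dquot mulrBl mulrAC mulVf// mul1r [s * r]mulrC.
    rewrite normrM ler_pM2r// -[dquot _ _ _ _](subrK D) -addrA.
    rewrite (le_trans (ler_normD _ _))// [leRHS]splitr lerD//; last exact: ltW.
    by rewrite -uD.
  have [d1 d10 H1] := near_affine (rmx v) A (ratr a) erefl aA.
  have [d2 d20 H2] := near_affine (rmx w) B (ratr b) erefl bB.
  have [d3 d30 H3] := near_affine (rmx v + rmx w) C (ratr c) erefl cC.
  have dm : 0 < Num.min d1 (Num.min d2 d3) by rewrite !lt_min d10 d20.
  have [k _ /(_ _ (leqnn _)) /= kd] := near_infty_natSinv_lt (PosNum dm).
  move: kd; rewrite !lt_min => /andP[k1 /andP[k2 k3]].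
  exists (v, w, (a, b, c), (j, k)) => //; rewrite /bad2 v0; split.
  - rewrite -/e; move: je aA bB cC ABC.
    by case: (ger0P (A + B - C)); case: (ger0P (ratr a + ratr b - ratr c));
      rewrite !ltr_norml; lra.
  - by move=> s sk; apply: H1; exact: lt_trans sk k1.
  - by move=> s sk; apply: H2; exact: lt_trans sk k2.
  - by move=> s sk; apply: H3; exact: lt_trans sk k3.
suff gD (v w : 'rV[R]_(1 + n)) : 'D_(v + w) l x = 'D_v l x + 'D_w l x.
  by have [] := differentiable_of_derivable lK dx gD.
apply/eqP; rewrite -subr_eq0 -normr_le0; apply/ler_addgt0Pr => e e0.
rewrite add0r.
have K1 : 0 < `|K| + 1 by rewrite ltr_wpDl.
have [e1 [e10 Ke1]] : exists e1, 0 < e1 /\ `|K| * e1 <= e / 4.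
  exists (e / 4 / (`|K| + 1)); split; first by rewrite !divr_gt0.
  by rewrite mulrCA -[leRHS]mulr1 ler_pM2l ?divr_gt0// ler_pdivrMr// mul1r lerDl.
have [p vp p0] := rdense v _ e10; have [q wq q0] := rdense w _ e10.
have Kle (u : 'rV[R]_(1 + n)) : `|u| < e1 -> `|K| * `|u| <= e / 4.
  by move=> /ltW ue; rewrite (le_trans _ Ke1)// ler_wpM2l.
have h1 := le_trans (derive_dir_le lK dx v (rmx p)) (Kle _ vp).
have h2 := le_trans (derive_dir_le lK dx w (rmx q)) (Kle _ wq).
have h3 : `|'D_(v + w) l x - 'D_(rmx p + rmx q) l x| <= e / 2.
  apply: (le_trans (derive_dir_le lK dx _ _)).
  rewrite opprD addrACA (@le_trans _ _ (`|K| * (`|v - rmx p| + `|w - rmx q|)))//.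
    by rewrite ler_wpM2l// ler_normD.
  rewrite mulrDr (_ : e / 2 = e / 4 + e / 4); last by lra.
  by rewrite lerD// Kle.
move: h1 h2 h3; rewrite (add_rat p q p0) !ler_norml; lra.
Qed.

End almost_everywhere_differentiable.

(** * A mean value inequality at points of differentiability *)

Lemma differentiable_translate (R : realType) (V W : normedModType R) (f : V -> W) a y :
  differentiable (fun z => f (a + z)) y ->
  differentiable f (a + y) /\ 'd f (a + y) = 'd (fun z => f (a + z)) y :> (V -> W).
Proof.
move=> df; have cL := diff_continuous df.
apply: (differentiable_eps cL) => e e0.
by have := eps_differentiable df e0; apply: filterS => h; rewrite addrCA.
Qed.

Lemma differentiable_near (R : realType) (V W : normedModType R) (f g : V -> W) y :
  (\forall z \near y, f z = g z) -> differentiable f y ->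
  differentiable g y /\ 'd g y = 'd f y :> (V -> W).
Proof.
move=> fg df; have cL := diff_continuous df.
apply: (differentiable_eps cL) => e e0.
have Hs := eps_differentiable df e0.
have fy : f y = g y by exact: nbhs_singleton fg.
move: fg; rewrite [X in X -> _](near_shift 0) subr0/= => fg.
by apply: filterS2 fg Hs => h /= <-; rewrite fy.
Qed.

(** Without such a [q], the derivative along [v] is at most [c] almost everywhere on some parallel
    segment starting close to [x]. So [l] grows by at most [c * h] on it, and shifting the segment
    back to [x] costs less than the excess [gap]. *)
Lemma lipschitz_mvt_transverse (R : realType) n (l : 'rV[R]_(1 + n) -> R) (K : R)
    (x v : 'rV[R]_(1 + n)) (h c e : R) :
  (forall x y, `|l x - l y| <= K * `|x - y|) -> v 0 0 != 0 ->
  0 < h -> 0 < e -> c * h < l (x + h *: v) - l x ->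
  exists q s, [/\ 0 <= s <= h, `|q - (x + s *: v)| < e, differentiable l q &
    c < 'd l q v].
Proof.
move=> lK v0 h0 e0 ch.
(* Centred at [x], because the good lines provided start in the hyperplane of first coordinate 0,
   near 0. *)
pose l' y := l (x + y).
have l'K y z : `|l' y - l' z| <= K * `|y - z|.
  by rewrite (le_trans (lK _ _))// opprD addrACA subrr add0r.
have [d [T [mu [phi [tau Hq]]]]] := exists_quasi_invariant R n.
have [mphi _ _ _ muball] := Hq.
have Hae := lines_of_null_slices Hq (borel_rademacher_bad l'K) v0
  (null_slices_rademacher_bad l'K Hq).
pose gap := l (x + h *: v) - l x - c * h.
have gap0 : 0 < gap by rewrite subr_gt0.
have K1 : 0 < 2 * `|K| + 1 by rewrite ltr_wpDl// mulr_ge0.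
pose r := Num.min e (gap / (2 * `|K| + 1)).
have r0 : 0 < r by rewrite lt_min e0 divr_gt0.
(* A ball of nonzero measure cannot consist of base points of bad lines only. *)
have [t tr Ht] : exists2 t, `|phi t| < r & {ae (@lebesgue_measure R), forall s,
    ~ rademacher_bad l' (rv_cons 0 (phi t) + s *: v)}.
  apply: contrapT => H; have /negP := muball r r0; apply; apply/eqP.
  have mB : measurable (phi @^-1` ball 0 r).
    by apply: borel_preimage => //; apply: borel_open; exact: ball_open.
  apply/(ae_measurableP mu mB); have FF := ae_filter_ringOfSetsType mu.
  move: Hae; apply: filterS => t Ht.
  rewrite /preimage ball_mxE/= sub0r normrN => tr; apply: H; by exists t.
pose y := rv_cons 0 (phi t).
have yr : `|y| < r by rewrite norm_rv_cons normr0 gt_max r0.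
apply: contrapT => H.
pose g s := l' (y + s *: v).
have : g h - g 0 <= c * (h - 0).
  apply: (lipschitz_le_of_ae_deriv_le (line_lipschitz l'K y v) (ltW h0)).
  have FF := ae_filter_ringOfSetsType (@lebesgue_measure R).
  move: Ht; apply: filterS => s /(differentiable_not_bad l'K) ds /andP[s0 sh].
  rewrite line_derive leNgt; apply/negP => cs; apply: H.
  have [dl dE] := differentiable_translate ds.
  exists (x + (y + s *: v)), s; split.
  - by rewrite sh ltW.
  - have -> : x + (y + s *: v) - (x + s *: v) = y by rewrite opprD addrACA subrr add0r addrK.
    by apply: lt_le_trans yr _; rewrite /r ge_min lexx.
  - exact: dl.
  - by rewrite dE -(deriveE v ds).
rewrite subr0 /g scale0r addr0 leNgt => /negP; apply.
have := l'K y 0; have := l'K (y + h *: v) (h *: v).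
rewrite addrK subr0 /l' !addr0.
have yK : K * `|y| <= `|K| * `|y| by rewrite ler_wpM2r// ler_norm.
have : (2 * `|K| + 1) * `|y| < gap.
  rewrite mulrC -ltr_pdivlMr//; apply: lt_le_trans yr _.
  by rewrite /r ge_min lexx orbT.
have := normr_ge0 y.
by rewrite /gap !ler_norml; lra.
Qed.

Lemma lipschitz_mvt (R : realType) m (l : 'rV[R]_m -> R) (K : R)
    (x u : 'rV[R]_m) (h c e : R) :
  (forall x y, `|l x - l y| <= K * `|x - y|) ->
  0 < h -> 0 < e -> c * h < l (x + h *: u) - l x ->
  exists q s, [/\ 0 <= s <= h, `|q - (x + s *: u)| < e, differentiable l q &
    c < 'd l q u].
Proof.
case: m l x u => [|n] l x u lK h0 e0 ch.
  exists x, 0; rewrite scale0r addr0 subrr normr0 lexx (ltW h0); split=> //.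
    have -> : l = cst (l 0) by apply/funext => y; rewrite [y]thinmx0.
    exact: differentiable_cst.
  rewrite [u]thinmx0 linear0; move: ch.
  by rewrite [u]thinmx0 scaler0 addr0 subrr pmulr_llt0.
pose gap := l (x + h *: u) - l x - c * h.
have gap0 : 0 < gap by rewrite subr_gt0.
pose M := `|K| + 1.
have M0 : 0 < M by rewrite ltr_wpDl.
(* Replacing [u] by [v] costs at most [gap / 4] in the increment and [gap / (4 * h)] in the final
   derivative; the slope [c + gap / (2 * h)] taken for [v] leaves room for both. The first bound
   moves the segment by at most [e / 2]. *)
pose r := Num.min (e / (2 * h)) (gap / (4 * h * M)).
have r0 : 0 < r by rewrite lt_min !divr_gt0// !mulr_gt0.
have [q0 [uq /(_ 0 0) q00]] := rat_mx_dense u r0.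
pose v : 'rV[R]_(1 + n) := map_mx ratr q0.
have v0 : v 0 0 != 0 by rewrite mxE fmorph_eq0.
have urM : h * (`|K| * `|u - v|) <= gap / 4.
  apply: (@le_trans _ _ (h * (M * r))).
    by rewrite ler_pM2l//; apply: ler_pM => //; [rewrite /M lerDl|exact: ltW].
  have : r <= gap / (4 * h * M) by rewrite /r ge_min lexx orbT.
  by rewrite ler_pdivlMr ?mulr_gt0// => hr; lra.
have hur : h * `|u - v| <= e / 2.
  apply: (@le_trans _ _ (h * r)); first by rewrite ler_pM2l// ltW.
  have : r <= e / (2 * h) by rewrite /r ge_min lexx.
  by rewrite ler_pdivlMr ?mulr_gt0// => hr; lra.
have [||q [s [sh qs dl cq]]] :=
    @lipschitz_mvt_transverse R n l K x v h (c + gap / (2 * h)) (e / 2) lK v0 h0.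
- by rewrite divr_gt0.
- rewrite mulrDl (_ : gap / (2 * h) * h = gap / 2); last by field; rewrite gt_eqF.
  have := lK (x + h *: u) (x + h *: v).
  rewrite opprD addrACA subrr add0r -scalerBr normrZ gtr0_norm// mulrCA.
  have : h * (K * `|u - v|) <= h * (`|K| * `|u - v|).
    by rewrite ler_pM2l// ler_wpM2r// ler_norm.
  move: urM; rewrite ler_norml /gap; lra.
exists q, s; split; [exact: sh| |exact: dl|].
  rewrite -[q](subrK (x + s *: v)) -addrA.
  rewrite (le_lt_trans (ler_normD _ _))// [ltRHS]splitr ltr_leD//.
  rewrite opprD addrACA subrr add0r -scalerBr normrZ distrC.
  case/andP: sh => s0 sh; rewrite ger0_norm//.
  by apply: le_trans hur; rewrite ler_wpM2r.
have := norm_diff_le (v - u) lK dl; rewrite linearB [`|v - u|]distrC.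
have : `|K| * `|u - v| <= gap / (4 * h).
  by rewrite ler_pdivlMr ?mulr_gt0// mulrC -mulrA mulrC -ler_pdivlMr.
have : 0 < gap / (4 * h) by rewrite divr_gt0// mulr_gt0.
move: cq; rewrite (_ : gap / (2 * h) = 2 * (gap / (4 * h))); last by field; rewrite gt_eqF.
rewrite ler_norml; lra.
Qed.

(** * Convex hulls and separation *)

Section caratheodory.
Context (R : realType) (m : nat).
Local Notation V := 'rV[R]_m.
Implicit Types (A : set V) (N : nat).

Definition combos N A : set V := [set p | exists (w : 'I_N -> R) (a : 'I_N -> V),
  [/\ forall i, 0 <= w i, \sum_i w i = 1, forall i, A (a i) & p = \sum_i w i *: a i]].

(** The combinations of [N.+1] points, as successive mixings, so that compactness follows by
    induction from the continuity of one mixing; [combos] is the form in which points are merged and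
    discarded. *)
Fixpoint iter_hull N A : set V :=
  if N is N'.+1 then
    [set p | exists t a b, [/\ 0 <= t <= 1, A a, iter_hull N' A b & p = t *: a + (1 - t) *: b]]
  else A.

Lemma combos_sub_iter_hull N A : combos N.+1 A `<=` iter_hull N A.
Proof.
elim: N => [|N IH] p [w [a [w0 w1 Aa ->]]].
  by move: w1; rewrite !big_ord1 => ->; rewrite scale1r; exact: Aa.
have wr : \sum_(i < N.+1) w (lift ord0 i) = 1 - w ord0.
  by have := w1; rewrite big_ord_recl => <-; rewrite addrAC subrr add0r.
have wr0 : 0 <= 1 - w ord0 by rewrite -wr sumr_ge0.
(* A remaining weight 0 cannot be normalized; the tail is then arbitrary, and [a ord0] is taken. *)
have [w01|w01] := eqVneq (1 - w ord0) 0.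
  have wz i : w (lift ord0 i) = 0.
    have wr' := wr; rewrite w01 in wr'.
    by apply: (psumr_eq0P _ wr') => // j _; exact: w0.
  exists 1, (a ord0), (a ord0); split=> //.
  - by rewrite ler01 lexx.
  - apply: IH; exists (fun i => (i == ord0)%:R), (fun=> a ord0); split => //.
    + by rewrite (bigD1 ord0)//= big1 ?addr0// => i /negPf ->.
    + by rewrite -scaler_suml (bigD1 ord0)//= big1 ?addr0 ?scale1r// => i /negPf ->.
  - rewrite big_ord_recl big1 => [|i _]; last by rewrite wz scale0r.
    rewrite subrr scale0r; congr (_ *: _ + _).
    by move/eqP : w01; rewrite subr_eq0 => /eqP <-.
exists (w ord0), (a ord0), (\sum_i (w (lift ord0 i) / (1 - w ord0)) *: a (lift ord0 i)).
split=> //.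
- by rewrite w0 -subr_ge0.
- apply: IH; exists (fun i => w (lift ord0 i) / (1 - w ord0)), (fun i => a (lift ord0 i)).
  split=> //; first by move=> i; rewrite divr_ge0.
  by rewrite -mulr_suml wr divff.
- rewrite big_ord_recl scaler_sumr; congr (_ + _); apply: eq_bigr => i _.
  by rewrite scalerA mulrCA divff// mulr1.
Qed.

Lemma iter_hull_sub_combos N A : iter_hull N A `<=` combos N.+1 A.
Proof.
elim: N => [|N IH] p /=.
  by move=> Ap; exists (fun=> 1), (fun=> p); split=> //; rewrite big_ord1 ?scale1r.
move=> [t [a [b [/andP[t0 t1] Aa /IH [w [c [w0 w1 Ac ->]]] ->]]]].
exists (fun i => oapp (fun j => (1 - t) * w j) t (unlift ord0 i)),
  (fun i => oapp c a (unlift ord0 i)); split.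
- by move=> i; case: unliftP => [j|] _ //=; rewrite mulr_ge0// subr_ge0.
- rewrite big_ord_recl unlift_none.
  by under eq_bigr do rewrite liftK/=; rewrite -mulr_sumr w1 mulr1 subrKC.
- move=> i; case: unliftP => [j|] _ /=; last exact: Aa.
  exact: Ac.
- rewrite [RHS]big_ord_recl unlift_none scaler_sumr; congr (_ + _).
  by apply: eq_bigr => i _; rewrite liftK/= scalerA.
Qed.

Lemma combos_mix N M A x y t : 0 <= t <= 1 -> combos N A x -> combos M A y ->
  combos (N + M) A (t *: x + (1 - t) *: y).
Proof.
move=> /andP[t0 t1] [w [a [w0 w1 Aa ->]]] [v [b [v0 v1 Ab ->]]].
exists (fun i => match fintype.split i with inl j => t * w j | inr k => (1 - t) * v k end),
  (fun i => match fintype.split i with inl j => a j | inr k => b k end); split.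
- by move=> i; case: fintype.split => j; rewrite mulr_ge0// subr_ge0.
- rewrite big_split_ord/=.
  under eq_bigr do rewrite (unsplitK (inl _)).
  under [X in _ + X]eq_bigr do rewrite (unsplitK (inr _)).
  by rewrite -!mulr_sumr w1 v1 !mulr1 subrKC.
- by move=> i; case: fintype.split.
- rewrite big_split_ord/= !scaler_sumr; congr (_ + _).
    by apply: eq_bigr => i _; rewrite (unsplitK (inl _)) scalerA.
  by apply: eq_bigr => i _; rewrite (unsplitK (inr _)) scalerA.
Qed.

(* Caratheodory: subtract from the weights the largest admissible multiple of
   an affine dependence between the points, so that one weight vanishes. *)
Lemma combos_reduce N A : (m < N)%N -> combos N.+1 A `<=` combos N A.
Proof.
move=> mN p [w [a [w0 w1 Aa ->]]].
(* More than [m + 1] rows are dependent, and the column of ones makes the coefficients sum to 0, so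
   that one of them is positive. *)
pose M : 'M[R]_(N.+1, m + 1) := row_mx (\matrix_i a i) (const_mx 1).
have : kermx M != 0.
  rewrite -mxrank_eq0 mxrank_ker subn_eq0 -ltnNge.
  by rewrite (leq_ltn_trans (rank_leq_col _))// addn1 ltnS.
move=> /rowV0Pn[mu /sub_kermxP muM mu0].
have {muM}[mua mu1] : \sum_i mu 0 i *: a i = 0 /\ \sum_i mu 0 i = 0.
  move: muM; rewrite mul_mx_row -row_mx0 => /eq_row_mx[].
  rewrite mulmx_sum_row => h1 h2; split.
    by rewrite -[RHS]h1; apply: eq_bigr => i _; rewrite rowK.
  have := congr1 (fun Z : 'M[R]_(1, 1) => Z 0 0) h2; rewrite !mxE => E.
  by rewrite -[RHS]E; apply: eq_bigr => i _; rewrite mxE mulr1.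
have [i1 i1P] : exists i, 0 < mu 0 i.
  apply: contrapT => /forallNP H; move/eqP: mu0; apply; apply/rowP => i.
  rewrite mxE; apply/eqP; rewrite -oppr_eq0; apply/eqP.
  have mu1' : \sum_i - mu 0 i = 0 by rewrite sumrN mu1 oppr0.
  apply: (psumr_eq0P _ mu1') => // j _.
  by rewrite oppr_ge0 leNgt; apply/negP; exact: H.
case: (@arg_minP _ _ _ i1 (fun i => 0 < mu 0 i) (fun i => w i / mu 0 i) i1P) => i0 i0P min0.
pose t := w i0 / mu 0 i0.
have t0 : 0 <= t by rewrite divr_ge0// ltW.
pose w' i := w i - t * mu 0 i.
have w'0 i : 0 <= w' i.
  rewrite subr_ge0; have [mui|mui] := ltP 0 (mu 0 i).
    by rewrite -ler_pdivlMr// min0.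
  by rewrite (le_trans _ (w0 i))// mulr_ge0_le0.
have w'i0 : w' i0 = 0 by rewrite /w' /t divfK ?subrr// gt_eqF.
exists (fun i => w' (lift i0 i)), (fun i => a (lift i0 i)); split=> //.
  have E : \sum_i w' i = w' i0 + \sum_(i < N) w' (lift i0 i).
    exact: (@bigD1_ord R +%R 0 _ i0 xpredT).
  by rewrite w'i0 add0r in E; rewrite -E sumrB w1 -mulr_sumr mu1 mulr0 subr0.
have E : \sum_i w' i *: a i = w' i0 *: a i0 + \sum_(i < N) w' (lift i0 i) *: a (lift i0 i).
  exact: (@bigD1_ord V +%R 0 _ i0 xpredT).
rewrite w'i0 scale0r add0r in E; rewrite -E.
under [RHS]eq_bigr do rewrite scalerBl -scalerA.
by rewrite sumrB -scaler_sumr mua scaler0 subr0.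
Qed.

(** Mixing doubles the number of points, and Caratheodory brings it back to [m.+1]; hence the depth
    [m]. *)
Lemma iter_hull_convex A x y t : 0 <= t <= 1 -> iter_hull m A x -> iter_hull m A y ->
  iter_hull m A (t *: x + (1 - t) *: y).
Proof.
move=> t01 /iter_hull_sub_combos hx /iter_hull_sub_combos hy.
apply: combos_sub_iter_hull; have := combos_mix t01 hx hy.
have red k : combos (k + m.+1)%N A `<=` combos m.+1 A.
  elim: k => [|k IH]; first by rewrite add0n.
  by apply: subset_trans IH; rewrite addSn; apply: combos_reduce; rewrite addnS ltnS leq_addl.
exact: red.
Qed.

Lemma compact_iter_hull N A : compact A -> compact (iter_hull N A).
Proof.
move=> cA; elim: N => // N IH.
have c01 : compact (`[0, 1] : set R) by exact: segment_compact.
rewrite (_ : iter_hull N.+1 A = (fun q : R * V * V => q.1.1 *: q.1.2 + (1 - q.1.1) *: q.2) @`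
   ((`[0, 1] `*` A) `*` iter_hull N A)).
  apply: continuous_compact; last by apply: compact_setX => //; exact: compact_setX.
  apply: continuous_subspaceT => q.
  apply: cvgD; apply: cvgZ.
  - by apply: continuous_comp; [exact: cvg_fst|exact: cvg_fst].
  - by apply: continuous_comp; [exact: cvg_fst|exact: cvg_snd].
  - apply: cvgB; first exact: cvg_cst.
    by apply: continuous_comp; [exact: cvg_fst|exact: cvg_fst].
  - exact: cvg_snd.
apply/seteqP; split=> p /=.
  by move=> [t [a [b [t01 Aa hb ->]]]]; exists (t, a, b).
by move=> [[[t a] b] /= [[t01 Aa] hb] <-]; exists t, a, b; split.
Qed.

End caratheodory.

Lemma convex_setP (R : realType) (V : lmodType R) (C : set V) :
  @convex_set R V C <->
  forall x y t, 0 <= t <= 1 -> C x -> C y -> C (t *: x + (1 - t) *: y).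
Proof.
split=> H.
  move=> x y t /andP[t0 t1] Cx Cy.
  by have := H x y (Itv01 t0 t1); rewrite !inE; apply.
move=> x y t; rewrite !inE => Cx Cy.
by have := H x y t%:inum; apply => //; apply/andP; split.
Qed.

Section convex_hull.
Context (R : realType) (V : lmodType R).
Implicit Types A : set V.

Lemma sub_convex_hull A : A `<=` convex_hull A.
Proof. by move=> x Ax C [_]; apply. Qed.

Lemma convex_hull_min A C : @convex_set R V C -> A `<=` C -> convex_hull A `<=` C.
Proof. by move=> cC AC x; apply. Qed.

Lemma convex_hull_convex A x y t : 0 <= t <= 1 ->
  convex_hull A x -> convex_hull A y -> convex_hull A (t *: x + (1 - t) *: y).
Proof.
move=> t01 hx hy C [cC AC]; have /convex_setP := cC; apply => //; [exact: hx|exact: hy].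
Qed.

End convex_hull.

Lemma iter_hull_sub_convex_hull (R : realType) m N (A : set 'rV[R]_m) :
  iter_hull N A `<=` convex_hull A.
Proof.
elim: N => [|N IH] p; first exact: sub_convex_hull.
move=> [t [a [b [t01 Aa /IH hb ->]]]]; apply: convex_hull_convex => //.
exact: sub_convex_hull.
Qed.

(** * The Frobenius inner product *)

Section frobenius.
Context (R : realType) (m n : nat).
Implicit Types A B C : 'M[R]_(m, n).

Definition dot A B : R := \sum_i \sum_j A i j * B i j.

Lemma dotC A B : dot A B = dot B A.
Proof. by apply: eq_bigr => i _; apply: eq_bigr => j _; rewrite mulrC. Qed.

Lemma dotDl A B C : dot (A + B) C = dot A C + dot B C.
Proof.
rewrite /dot -big_split; apply: eq_bigr => i _.
by rewrite -big_split; apply: eq_bigr => j _; rewrite mxE mulrDl.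
Qed.

Lemma dotZl c A B : dot (c *: A) B = c * dot A B.
Proof.
rewrite /dot mulr_sumr; apply: eq_bigr => i _.
by rewrite mulr_sumr; apply: eq_bigr => j _; rewrite mxE mulrA.
Qed.

Lemma dotNl A B : dot (- A) B = - dot A B.
Proof. by rewrite -scaleN1r dotZl mulN1r. Qed.

Lemma dotBl A B C : dot (A - B) C = dot A C - dot B C.
Proof. by rewrite dotDl dotNl. Qed.

Lemma dotDr A B C : dot C (A + B) = dot C A + dot C B.
Proof. by rewrite !(dotC C) dotDl. Qed.

Lemma dotZr c A B : dot A (c *: B) = c * dot A B.
Proof. by rewrite !(dotC A) dotZl. Qed.

Lemma dotBr A B C : dot C (A - B) = dot C A - dot C B.
Proof. by rewrite !(dotC C) dotBl. Qed.

Lemma dot_sqr_subZ t A B : dot (A - t *: B) (A - t *: B) =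
  dot A A - 2 * t * dot A B + t * t * dot B B.
Proof. by rewrite dotBl !dotBr !dotZl !dotZr (dotC B A); ring. Qed.

Lemma dot_ge0 A : 0 <= dot A A.
Proof. by apply: sumr_ge0 => i _; apply: sumr_ge0 => j _; rewrite -expr2 sqr_ge0. Qed.

Lemma dot_eq0 A : dot A A = 0 -> A = 0.
Proof.
move=> A0; apply/matrixP => i j; rewrite mxE.
have h1 : \sum_k A i k * A i k = 0.
  apply: (psumr_eq0P _ A0) => // k _.
  by apply: sumr_ge0 => l _; rewrite -expr2 sqr_ge0.
have : A i j * A i j = 0.
  by apply: (psumr_eq0P _ h1) => // k _; rewrite -expr2 sqr_ge0.
by move/eqP; rewrite mulf_eq0 orbb => /eqP.
Qed.

Lemma normr_dot_le A B : `|dot A B| <= (m * n)%:R * (`|A| * `|B|).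
Proof.
apply: (le_trans (ler_norm_sum _ _ _)); rewrite natrM -mulrA.
apply: (@le_trans _ _ (\sum_(i < m) (n%:R * (`|A| * `|B|)))).
  apply: ler_sum => i _; apply: (le_trans (ler_norm_sum _ _ _)).
  apply: (@le_trans _ _ (\sum_(j < n) (`|A| * `|B|))).
    by apply: ler_sum => j _; rewrite normrM ler_pM// ler_entry_norm.
  by rewrite sumr_const card_ord -[leLHS]mulr_natl.
by rewrite sumr_const card_ord -[leLHS]mulr_natl.
Qed.

Lemma dot_delta A i j : dot A (delta_mx i j) = A i j.
Proof.
rewrite /dot (bigD1 i)//= (bigD1 j)//= mxE !eqxx mulr1 big1 => [|k kj]; last first.
  by rewrite mxE (negPf kj) andbF mulr0.
rewrite addr0 big1 ?addr0// => k ki; rewrite big1// => l _.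
by rewrite mxE (negPf ki) mulr0.
Qed.

Lemma dot_inj A B : (forall v, dot A v = dot B v) -> A = B.
Proof. by move=> H; apply/matrixP => i j; rewrite -!dot_delta. Qed.

Lemma norm_delta_mx_le (i : 'I_m) (j : 'I_n) : `|delta_mx i j : 'M[R]_(m, n)| <= 1.
Proof.
apply: mx_norm_le => // k l; rewrite mxE.
by case: (_ && _); rewrite ?normr1 ?normr0.
Qed.

End frobenius.

Lemma near_dist_lt (R : realType) (V : normedModType R) (A : V) e : 0 < e ->
  \forall B \near A, `|A - B| < e.
Proof. by move=> e0; have := @nbhsx_ballx _ _ A e e0; rewrite -ball_normE. Qed.

Lemma continuous_eps (R : realType) (V W : normedModType R) (f : V -> W) :
  (forall x e, 0 < e -> exists2 d, 0 < d & forall y, `|x - y| < d -> `|f x - f y| <= e) ->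
  continuous f.
Proof.
move=> H x; apply/cvgrPdist_le => e e0; have [d d0 Hd] := H x e e0.
by have := near_dist_lt x d0; apply: filterS => y /Hd.
Qed.

(** [v] is [s - p] for the point [p] of [C] nearest to [s] in the Frobenius norm, and [e] is the
    squared distance. *)
Lemma compact_convex_separation (R : realType) m n (C : set 'M[R]_(m, n)) s :
  compact C -> (forall x y t, 0 <= t <= 1 -> C x -> C y -> C (t *: x + (1 - t) *: y)) ->
  C !=set0 -> ~ C s ->
  exists v e, 0 < e /\ forall c, C c -> dot c v <= dot s v - e.
Proof.
move=> cC convC C0 Cs.
have cf : continuous (fun x : 'M[R]_(m, n) => dot (s - x) (s - x)).
  have c1 : continuous (fun A : 'M[R]_(m, n) => dot A A).
    apply: (@continuous_eps R _ R^o) => A e e0.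
    have M0 : 0 < (m * n)%:R * (2 * `|A| + 1) + 1.
      by rewrite ltr_wpDl// mulr_ge0// addr_ge0// mulr_ge0.
    exists (Num.min 1 (e / ((m * n)%:R * (2 * `|A| + 1) + 1))).
      by rewrite lt_min ltr01 divr_gt0.
    move=> B; rewrite lt_min => /andP[/ltW AB1 /ltW ABe].
    rewrite (_ : dot A A - dot B B = dot (A - B) (A + B)); last first.
      by rewrite dotBl !dotDr [dot B A]dotC; ring.
    apply: (le_trans (normr_dot_le _ _)).
    have ApB : `|A + B| <= 2 * `|A| + 1.
      rewrite (_ : A + B = A + A - (A - B)); last by rewrite opprB -addrA subrKC.
      rewrite (le_trans (ler_normB _ _))// lerD//.
      by rewrite (le_trans (ler_normD _ _))// mulr2n mulrDl mul1r.
    apply: (@le_trans _ _ (`|A - B| * ((m * n)%:R * (2 * `|A| + 1) + 1))); last first.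
      by rewrite -ler_pdivlMr.
    rewrite mulrCA ler_wpM2l//; apply: (@le_trans _ _ ((m * n)%:R * (2 * `|A| + 1))).
      by rewrite ler_wpM2l.
    by rewrite lerDl.
  have c2 : continuous (fun x : 'M[R]_(m, n) => s - x).
    apply: (@lipschitz_continuous R 'M[R]_(m, n) 'M[R]_(m, n) _ 1) => x y.
    by rewrite mul1r opprB addrC subrKA distrC.
  by move=> x; exact: continuous_comp (c2 x) (c1 (s - x)).
have [p Cp pmin] : exists2 p, C p & forall c, C c -> dot (s - p) (s - p) <= dot (s - c) (s - c).
  have [|p Cp H] := @compact_EVT_min _ R (fun x : 'M[R]_(m, n) => dot (s - x) (s - x)) C C0 cC.
    exact: continuous_subspaceT.
  by exists p; [rewrite inE in Cp|move=> c Cc; apply: H; rewrite inE].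
have sp0 : 0 < dot (s - p) (s - p).
  rewrite lt_neqAle dot_ge0 andbT eq_sym; apply/eqP => /dot_eq0 /eqP.
  by rewrite subr_eq0 => /eqP sE; apply: Cs; rewrite sE.
exists (s - p), (dot (s - p) (s - p)); split => // c Cc.
suff H : dot (s - p) (c - p) <= 0.
  have E1 : dot c (s - p) = dot (s - p) (c - p) + dot p (s - p).
    by rewrite [dot (s - p) (c - p)]dotBr [dot p _]dotC subrK dotC.
  have E2 : dot (s - p) (s - p) = dot s (s - p) - dot p (s - p) by rewrite dotBl.
  by lra.
rewrite leNgt; apply/negP => H.
set a := dot (s - p) (c - p) in H; set b := dot (c - p) (c - p).
have b0 : 0 <= b by exact: dot_ge0.
(* A step [t] from [p] towards [c] changes the squared distance by [t * t * b - 2 * t * a], negative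
   for this [t], against the minimality of [p]. *)
pose t := Num.min 1 (a / (b + 1)).
have b1 : 0 < b + 1 by rewrite ltr_wpDl.
have t0 : 0 < t by rewrite lt_min ltr01 divr_gt0.
have t1 : t <= 1 by rewrite /t ge_min lexx.
have ta : t * (b + 1) <= a by rewrite -ler_pdivlMr// /t ge_min lexx orbT.
have := pmin _ (convC c p t _ Cc Cp); rewrite (ltW t0) t1 => /(_ isT).
rewrite (_ : s - (t *: c + (1 - t) *: p) = (s - p) - t *: (c - p)); last first.
  by apply/matrixP => i j; rewrite !mxE; ring.
rewrite dot_sqr_subZ -/a -/b.
have : t * t * b <= t * a.
  rewrite -mulrA ler_pM2l//; apply: le_trans ta.
  by rewrite ler_pM2l// lerDl.
have : 0 < t * a by rewrite mulr_gt0.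
lra.
Qed.

(** * Limiting gradients *)

Lemma diff_gradient (R : realType) m n (f : 'M[R]_(m, n) -> R) x v :
  differentiable f x -> 'd f x v = dot (gradient f x) v.
Proof.
move=> df; rewrite {1}[v]matrix_sum_delta raddf_sum; apply: eq_bigr => i _.
rewrite raddf_sum; apply: eq_bigr => j _.
transitivity (v i j *: 'd f x (delta_mx i j)); first exact: linearZ.
by rewrite mxE deriveE//; exact: mulrC.
Qed.

Lemma limiting_gradientsP (R : realType) m n (f : 'M[R]_(m, n) -> R) x s :
  limiting_gradients f x s <-> forall e, 0 < e ->
    exists y, [/\ `|x - y| < e, differentiable f y & `|s - gradient f y| < e].
Proof.
split=> [[y [yx dy ys]] e e0|H].
  have /cvgrPdist_lt/(_ e e0) h1 := yx; have /cvgrPdist_lt/(_ e e0) h2 := ys.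
  have [k [xk sk]] := filter_ex (filterI h1 h2).
  by exists (y k); split; [exact: xk|exact: dy|exact: sk].
have inv0 k : 0 < k.+1%:R^-1 :> R by rewrite invr_gt0.
have /choice [y Hy] : forall k : nat, exists y, [/\ `|x - y| < k.+1%:R^-1,
    differentiable f y & `|s - gradient f y| < k.+1%:R^-1].
  by move=> k; exact: H (inv0 k).
have small (e : R) : 0 < e -> \forall k \near \oo, k.+1%:R^-1 < e.
  by move=> e0; exact: (near_infty_natSinv_lt (PosNum e0)).
exists y; split.
- apply/cvgrPdist_lt => e e0; have := small e e0; apply: filterS => k.
  by apply: lt_trans; have [] := Hy k.
- by move=> k; have [] := Hy k.
- apply/cvgrPdist_lt => e e0; have := small e e0; apply: filterS => k.
  by apply: lt_trans; have [] := Hy k.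
Qed.

Lemma closed_limiting_gradients (R : realType) m n (f : 'M[R]_(m, n) -> R) x :
  closed (limiting_gradients f x).
Proof.
move=> s Hs; apply/limiting_gradientsP => e e0.
have e2 : 0 < e / 2 by rewrite divr_gt0.
have ee : e / 2 < e by rewrite ltr_pdivrMr// ltr_pMr// ltr1n.
have [t [/limiting_gradientsP /(_ _ e2) [y [xy dy ty]]]] := Hs _ (nbhsx_ballx s _ e2).
rewrite ball_mxE/= => st; exists y; split=> //; first exact: lt_trans xy ee.
by rewrite (le_lt_trans (ler_distD t _ _))// [ltRHS]splitr ltrD.
Qed.

Lemma min_dist_le (R : realDomainType) (a x y : R) :
  `|Num.min a x - Num.min a y| <= `|x - y|.
Proof.
rewrite ler_norml; have := ler_norm (x - y); have := ler_norm (y - x).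
rewrite (distrC y); move: `|_| => D.
by case: (leP a x); case: (leP a y); lra.
Qed.

Lemma max_dist_le (R : realDomainType) (a x y : R) :
  `|Num.max a x - Num.max a y| <= `|x - y|.
Proof.
rewrite ler_norml; have := ler_norm (x - y); have := ler_norm (y - x).
rewrite (distrC y); move: `|_| => D.
by case: (leP a x); case: (leP a y); lra.
Qed.

(** * Limiting gradients of locally Lipschitz functions *)

Section locally_lipschitz_row.
Context (R : realType) (m : nat) (l : 'rV[R]_m -> R).
Hypothesis hl : locally_lipschitz l.

Let clamp (z : 'rV[R]_m) (r : R) (y : 'rV[R]_m) : 'rV[R]_m :=
  \row_j Num.max (z 0 j - r) (Num.min (z 0 j + r) (y 0 j)).

Let clamp_lip z r x y : `|clamp z r x - clamp z r y| <= `|x - y|.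
Proof.
apply: mx_norm_le => // i j; rewrite !mxE.
have := ler_entry_norm (x - y) 0 j; rewrite !mxE; apply: le_trans.
by rewrite (le_trans (max_dist_le _ _ _))// min_dist_le.
Qed.

Let clamp_in z r y : 0 <= r -> `|z - clamp z r y| <= r.
Proof.
move=> r0; apply: mx_norm_le => // i j; rewrite !mxE !ord1 ler_norml.
case: (leP (z 0 j + r) (y 0 j)) => h1.
  by case: (leP (z 0 j - r) (z 0 j + r)) => h2; lra.
by case: (leP (z 0 j - r) (y 0 j)) => h2; lra.
Qed.

Let clamp_id z r y : `|z - y| <= r -> clamp z r y = y.
Proof.
move=> zy; apply/rowP => j; rewrite mxE.
have := le_trans (ler_entry_norm (z - y) 0 j) zy; rewrite !mxE ler_norml => H.
have -> : Num.min (z 0 j + r) (y 0 j) = y 0 j by apply/min_idPr; lra.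
by apply/max_idPr; lra.
Qed.

(* Precomposition with the clamping to a cube makes l globally Lipschitz. *)
Lemma locally_lipschitz_extension z : exists r K l', [/\ 0 < r,
  forall x y, `|l' x - l' y| <= K * `|x - y| &
  forall y, `|z - y| <= r -> l' y = l y].
Proof.
have [U Uz [M [Mr HM]]] := hl z.
have /nbhs_ballP[d /= d0 dU] := Uz.
have d2 : 0 < d / 2 by rewrite divr_gt0.
have dd : d / 2 < d by rewrite ltr_pdivrMr// ltr_pMr// ltr1n.
(* The Lipschitz hypothesis gives the bound for constants strictly above [M]. *)
have M1 : M < M + 1 by rewrite ltrDl.
exists (d / 2), `|M + 1|, (l \o clamp z (d / 2)); split=> //.
- move=> x y /=.
  have inU t : U (clamp z (d / 2) t).
    by apply: dU; rewrite ball_mxE/= (le_lt_trans (clamp_in _ _ _))// ltW.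
  have := HM _ M1 (clamp z (d / 2) x, clamp z (d / 2) y) (conj (inU x) (inU y)).
  move=> /= /le_trans; apply.
  by rewrite (le_trans (ler_wpM2r _ (ler_norm _)))// ler_wpM2l.
- by move=> y zy /=; rewrite clamp_id.
Qed.

(** All is transferred from the extension, which agrees with [l] around each point at distance less
    than [r] from [z] and so has the same differential there. The [r / 2] leaves room for [q] to be
    off the segment. *)
Lemma locally_lipschitz_near z : exists r K, [/\ 0 < r, 0 <= K,
  forall x y, `|z - x| <= r -> `|z - y| <= r -> `|l x - l y| <= K * `|x - y|,
  forall x, `|z - x| < r -> differentiable l x -> `|gradient l x| <= K &
  forall x u h c e, 0 < h -> 0 < e -> `|z - x| + h * `|u| < r / 2 ->
    c * h < l (x + h *: u) - l x ->
    exists q, [/\ `|x - q| < h * `|u| + e, differentiable l q & c < 'd l q u]].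
Proof.
have [r [K [l' [r0 l'K l'E]]]] := locally_lipschitz_extension z.
have nearE x : `|z - x| < r -> \forall y \near x, l' y = l y.
  move=> zx; have d0 : 0 < r - `|z - x| by rewrite subr_gt0.
  have := near_dist_lt x d0; apply: filterS => y xy; apply: l'E.
  by rewrite (le_trans (ler_distD x _ _))// -lerBrDl ltW.
exists r, `|K|; split=> //.
- move=> x y zx zy; rewrite -!l'E// (le_trans (l'K _ _))// ler_wpM2r// ler_norm.
  by [].
- move=> x zx dl.
  have ll' : \forall y \near x, l y = l' y by have := nearE x zx; apply: filterS => y ->.
  have [dl' dE] := differentiable_near ll' dl.
  apply: mx_norm_le => // i j; rewrite mxE deriveE// -dE.
  apply: (le_trans (norm_diff_le _ l'K dl')).
  by rewrite ler_piMr// norm_delta_mx_le.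
- move=> x u h c e h0 e0 zxu ch.
  have r2 : r / 2 < r by rewrite ltr_pdivrMr// ltr_pMr// ltr1n.
  have hu0 : 0 <= h * `|u| by rewrite mulr_ge0// ltW.
  have zx : `|z - x| <= r.
    by rewrite ltW// (lt_trans _ r2)// (le_lt_trans _ zxu)// lerDl.
  have zxh : `|z - (x + h *: u)| <= r.
    rewrite opprD addrA ltW// (le_lt_trans (ler_normB _ _))//.
    by rewrite normrZ (gtr0_norm h0) (lt_trans zxu).
  have [||q [s [/andP[s0 sh] qs dl cq]]] :=
    @lipschitz_mvt R m l' K x u h c (Num.min e (r / 2)) l'K h0.
  + by rewrite lt_min e0 divr_gt0.
  + by rewrite !l'E.
  have su : s * `|u| <= h * `|u| by rewrite ler_wpM2r.
  have xq : `|x - q| <= `|q - (x + s *: u)| + s * `|u|.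
    rewrite -[X in _ <= _ + X * _](ger0_norm s0) -normrZ distrC.
    rewrite (_ : q - x = (q - (x + s *: u)) + s *: u) ?ler_normD//.
    by rewrite opprD addrA subrK.
  move: qs; rewrite lt_min => /andP[qe qr].
  have zq : `|z - q| < r.
    rewrite (le_lt_trans (ler_distD x _ _))//; move: qr xq su zxu.
    by move: (s * _) (h * _) => a b; lra.
  have [dlq dE] := differentiable_near (nearE q zq) dl.
  exists q; split; [|exact: dlq|by rewrite dE].
  by move: qe xq su; move: (s * _) (h * _) => a b; lra.
Qed.

Lemma compact_limiting_gradients z : compact (limiting_gradients l z).
Proof.
apply: bounded_closed_compact; last exact: closed_limiting_gradients.
have [r [K [r0 K0 _ gK _]]] := locally_lipschitz_near z.
exists (K + 1); split; first by rewrite num_real.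
move=> M KM s /limiting_gradientsP H.
have m0 : 0 < Num.min r 1 by rewrite lt_min r0 ltr01.
have [y []] := H _ m0; rewrite !lt_min => /andP[zy _] dy /andP[_ sy].
have sK : `|s| <= 1 + K.
  rewrite -[s](subrK (gradient l y)); apply: (le_trans (ler_normD _ _)).
  exact: lerD (ltW sy) (gK y zy dy).
by apply: le_trans sK _; rewrite addrC ltW.
Qed.

(** The mean value inequality turns these quotients into points of differentiability tending to [z],
    whose gradients have products with [u] above [c] up to a vanishing error. The gradients are
    bounded, and [t] is a cluster point of them. *)
Lemma limiting_gradients_support z u c :
  (forall e, 0 < e -> exists x h, [/\ `|z - x| < e, 0 < h < e &
     (c - e) * h <= l (x + h *: u) - l x]) ->
  exists2 t, limiting_gradients l z t & c <= dot t u.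
Proof.
move=> H; have [r [K [r0 K0 _ gK mvt]]] := locally_lipschitz_near z.
have u1 : 0 < `|u| + 1 by rewrite ltr_wpDl.
have step e : 0 < e -> exists q, [/\ `|z - q| < e, differentiable l q,
    `|gradient l q| <= K & c - e < dot (gradient l q) u].
  move=> e0.
  (* Distance to [x], step along [u] and deviation from the segment each take at most a quarter of
     [e] and of [r]. *)
  pose d := Num.min (Num.min (e / 4) (r / 4)) (Num.min (e / (4 * (`|u| + 1))) (r / (4 * (`|u| + 1)))).
  have d0 : 0 < d by rewrite !lt_min !divr_gt0// mulr_gt0.
  have [x [h [zx /andP[h0 hd] ch]]] := H d d0.
  have [de dr deu dru] : [/\ d <= e / 4, d <= r / 4, d * (`|u| + 1) <= e / 4 &
      d * (`|u| + 1) <= r / 4].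
    have e1 : d <= e / (4 * (`|u| + 1)) by rewrite /d !ge_min lexx !orbT.
    have e2 : d <= r / (4 * (`|u| + 1)) by rewrite /d !ge_min lexx !orbT.
    split; try by rewrite /d !ge_min lexx ?orbT.
    - by move: e1; rewrite ler_pdivlMr ?mulr_gt0//; lra.
    - by move: e2; rewrite ler_pdivlMr ?mulr_gt0//; lra.
  have hu : h * `|u| <= d * (`|u| + 1) by apply: ler_pM => //; [exact: ltW|exact: ltW|rewrite lerDl].
  have [|||q [xq dq cq]] := mvt x u h (c - e / 2) (Num.min (e / 4) (r / 4)) h0.
  - by rewrite lt_min !divr_gt0.
  - by move: (h * _) hu => A hu; lra.
  - apply: lt_le_trans ch; rewrite ltr_pM2r//; lra.
  have zq : `|z - q| < Num.min e r.
    rewrite (le_lt_trans (ler_distD x _ _))//.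
    have : `|z - x| + `|x - q| < d + (d * (`|u| + 1) + Num.min (e / 4) (r / 4)).
      by rewrite ltrD// (lt_le_trans xq)// lerD2r.
    move=> /lt_le_trans; apply; rewrite le_min.
    have : Num.min (e / 4) (r / 4) <= e / 4 by rewrite ge_min lexx.
    have : Num.min (e / 4) (r / 4) <= r / 4 by rewrite ge_min lexx orbT.
    move: de dr deu dru; move: (Num.min _ _) (d * _) => A B; lra.
  exists q; split; [ | exact: dq| |].
  - by move: zq; rewrite lt_min => /andP[].
  - by apply: gK => //; move: zq; rewrite lt_min => /andP[].
  - rewrite -diff_gradient//; move: cq; lra.
have inv0 k : 0 < k.+1%:R^-1 :> R by rewrite invr_gt0.
have /choice [q Hq] : forall k : nat, exists q, [/\ `|z - q| < k.+1%:R^-1,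
    differentiable l q, `|gradient l q| <= K & c - k.+1%:R^-1 < dot (gradient l q) u].
  by move=> k; exact: step (inv0 k).
have cB : compact (closed_ball (0 : 'rV[R]_m) (K + 1)).
  apply: bounded_closed_compact; last exact: closed_ball_closed.
  exists (K + 1); split; first by rewrite num_real.
  move=> M KM y; rewrite closed_ballE ?ltr_wpDl// /closed_ball_/= sub0r normrN => h.
  exact: le_trans h (ltW KM).
have small (e : R) : 0 < e -> \forall k \near \oo, k.+1%:R^-1 < e.
  by move=> e0; exact: (near_infty_natSinv_lt (PosNum e0)).
have [t [_ Ht]] : exists t, closed_ball (0 : 'rV[R]_m) (K + 1) t /\
    cluster ((fun k => gradient l (q k)) @ \oo) t.
  have [|t [tB tc]] := cB ((fun k => gradient l (q k)) @ \oo) _; last by exists t.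
  suff : \forall k \near \oo, closed_ball (0 : 'rV[R]_m) (K + 1) (gradient l (q k)) by [].
  apply: nearW => k; rewrite closed_ballE ?ltr_wpDl// /closed_ball_/= sub0r normrN.
  by have [_ _ h _] := Hq k; rewrite (le_trans h)// lerDl.
have clus (e e' : R) : 0 < e -> 0 < e' ->
    exists k, k.+1%:R^-1 < e /\ `|t - gradient l (q k)| < e'.
  move=> e0 e'0.
  pose S := [set s | exists k, k.+1%:R^-1 < e /\ gradient l (q k) = s].
  have FS : ((fun k => gradient l (q k)) @ \oo) S.
    suff : \forall k \near \oo, S (gradient l (q k)) by [].
    by have := small e e0; apply: filterS => k ke; exists k.
  have [s [[k [ke ks]] ts]] := Ht S (ball t e') FS (nbhsx_ballx t _ e'0).
  by exists k; split => //; move: ts; rewrite ball_mxE/= -ks.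
exists t.
  apply/limiting_gradientsP => e e0.
  have [k [ke tk]] := clus e e e0 e0; have [zq dq _ _] := Hq k.
  by exists (q k); split => //; exact: lt_trans zq ke.
apply/ler_addgt0Pr => e e0.
have e2 : 0 < e / 2 by rewrite divr_gt0.
pose M := (1 * m)%:R * `|u| + 1.
have M0 : 0 < M by rewrite ltr_wpDl// mulr_ge0.
have [k [ke tk]] := clus (e / 2) (e / 2 / M) e2 (divr_gt0 e2 M0).
have [_ _ _ cq] := Hq k.
have : `|dot (t - gradient l (q k)) u| <= e / 2.
  rewrite (le_trans (normr_dot_le _ _))//.
  rewrite ltr_pdivlMr// in tk; apply: le_trans (ltW tk).
  by rewrite mulrCA ler_wpM2l// /M lerDl.
rewrite dotBl ler_norml => /andP[h _].
by move: ke cq h; move: (k.+1%:R^-1) (dot _ _) (dot _ _) => i A B; lra.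
Qed.

End locally_lipschitz_row.

(** * The map HFM *)

Lemma differentiable_eps_delta (R : realType) (V W : normedModType R) (f : V -> W)
    (x : V) (L : {linear V -> W}) : continuous L ->
  (forall e, 0 < e -> exists2 d, 0 < d &
     forall h, `|h| < d -> `|f (h + x) - f x - L h| <= e * `|h|) ->
  differentiable f x /\ 'd f x = L :> (V -> W).
Proof.
move=> cL H; apply: differentiable_eps => // e e0; have [d d0 Hd] := H e e0.
have := near_dist_lt (0 : V) d0; apply: filterS => h.
by rewrite sub0r normrN; exact: Hd.
Qed.

Section jacobian_transpose.
Context (R : realType) (m n N : nat) (H : 'M[R]_(m, n) -> 'rV[R]_N).

Lemma continuous_vec_mx : continuous (@vec_mx R m n).
Proof.
apply: (@lipschitz_continuous R _ _ _ 1) => x y; rewrite mul1r -linearB.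
by apply: mx_norm_le => // i j; rewrite mxE ler_entry_norm.
Qed.

Lemma dot_vec_mx (w : 'rV[R]_(m * n)) (v : 'M[R]_(m, n)) :
  dot (vec_mx w) v = dot w (mxvec v).
Proof.
rewrite /dot pair_bigA [RHS]big_ord1 [RHS](reindex _ (curry_mxvec_bij m n)) /=.
apply: eq_bigr => -[i j] _ /=.
by rewrite mxE mxvecE.
Qed.

(** The adjoint identity: besides linearity, the only property of [jacobian_tr] used later. *)
Lemma dot_jacobian_tr x s v : differentiable H x ->
  dot (jacobian_tr H x s) v = dot s ('d H x v).
Proof.
move=> dH; rewrite /jacobian_tr /jacobian_mx trmxK dot_vec_mx.
have [dvec dvE] : differentiable (@vec_mx R m n) (mxvec x) /\
    'd (@vec_mx R m n) (mxvec x) = @vec_mx R m n :> (_ -> _).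
  apply: differentiable_eps_delta; first exact: continuous_vec_mx.
  move=> e e0; exists 1 => // h _.
  by rewrite linearD addrK subrr normr0 mulr_ge0// ltW.
have dH' : differentiable H (vec_mx (mxvec x)) by rewrite mxvecK.
set J := 'J _ _.
have JE : mxvec v *m J = 'd H x v.
  by rewrite /J /jacobian mul_rV_lin1 diff_comp//= dvE !mxvecK.
rewrite -JE /dot !big_ord1.
under eq_bigr do rewrite mxE mxE big_distrl /=.
under [RHS]eq_bigr do rewrite mxE big_distrr /=.
rewrite exchange_big/=; apply: eq_bigr => k _; apply: eq_bigr => i _.
rewrite [s^T _ _]mxE; ring.
Qed.

Lemma linear_jacobian_tr x : linear (jacobian_tr H x).
Proof.
move=> c s t; rewrite /jacobian_tr.
by rewrite linearD linearZ/= mulmxDr -scalemxAr linearD linearZ/= linearD linearZ.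
Qed.

Lemma gradient_comp x (l : 'rV[R]_N -> R) : differentiable H x -> differentiable l (H x) ->
  differentiable (l \o H) x /\
  gradient (l \o H) x = jacobian_tr H x (gradient l (H x)).
Proof.
move=> dH dl; have dlH : differentiable (l \o H) x by exact: differentiable_comp.
split => //; apply: dot_inj => v.
by rewrite -diff_gradient// diff_comp//= dot_jacobian_tr// -diff_gradient.
Qed.

End jacobian_transpose.

Section pairing.
Context (R : realType) (d d0 : nat) (a : 'I_d0 -> 'I_d0 -> R).
Local Notation N := ((d0.-1 * d0)./2).
Implicit Types P Q : 'M[R]_(d, d0).

(** A bilinear map with diagonal [HFM], not symmetrized: [P] supplies the first column of each pair
    and [Q] the second. *)
Definition pairing P Q : 'rV[R]_N :=
  \row_k (a (Defs.lt_pair k).1 (Defs.lt_pair k).2 *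
    \sum_r P r (Defs.lt_pair k).1 * Q r (Defs.lt_pair k).2).

Lemma HFM_pairing P : HFM a P = pairing P P.
Proof.
apply/rowP => k; rewrite !mxE; case: (Defs.lt_pair k) => i j /=; rewrite mxE.
by congr (_ * _); apply: eq_bigr => r _; rewrite !mxE.
Qed.

Lemma pairingDl P P' Q : pairing (P + P') Q = pairing P Q + pairing P' Q.
Proof.
apply/rowP => k; rewrite !mxE -mulrDr -big_split; congr (_ * _).
by apply: eq_bigr => r _; rewrite mxE mulrDl.
Qed.

Lemma pairingDr P Q Q' : pairing P (Q + Q') = pairing P Q + pairing P Q'.
Proof.
apply/rowP => k; rewrite !mxE -mulrDr -big_split; congr (_ * _).
by apply: eq_bigr => r _; rewrite mxE mulrDr.
Qed.

Lemma pairingZl c P Q : pairing (c *: P) Q = c *: pairing P Q.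
Proof.
apply/rowP => k; rewrite !mxE mulrCA; congr (_ * _); rewrite mulr_sumr.
by apply: eq_bigr => r _; rewrite mxE mulrA.
Qed.

Lemma pairingZr c P Q : pairing P (c *: Q) = c *: pairing P Q.
Proof.
apply/rowP => k; rewrite !mxE mulrCA; congr (_ * _); rewrite mulr_sumr.
by apply: eq_bigr => r _; rewrite mxE mulrCA.
Qed.

Lemma pairing_bounded : exists2 b : R, 0 <= b &
  forall P Q, `|pairing P Q| <= b * (`|P| * `|Q|).
Proof.
have S0 : 0 <= \sum_i \sum_j `|a i j| by apply: sumr_ge0 => i _; exact: sumr_ge0.
exists ((\sum_i \sum_j `|a i j|) * d%:R) => [|P Q]; first exact: mulr_ge0.
apply: mx_norm_le => [|i k]; first by rewrite !mulr_ge0.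
rewrite mxE normrM -mulrA ler_pM//.
  case: (Defs.lt_pair k) => p q /=.
  rewrite (bigD1 p)//= (bigD1 q)//= -addrA lerDl addr_ge0// ?sumr_ge0// => x _.
  by rewrite sumr_ge0.
apply: (le_trans (ler_norm_sum _ _ _)).
apply: (@le_trans _ _ (\sum_(r < d) (`|P| * `|Q|))).
  by apply: ler_sum => r _; rewrite normrM ler_pM// ler_entry_norm.
by rewrite sumr_const card_ord -[leLHS]mulr_natl.
Qed.

Lemma HFMD P Q : HFM a (P + Q) = HFM a P + (pairing P Q + pairing Q P) + HFM a Q.
Proof. by rewrite !HFM_pairing pairingDl !pairingDr !addrA. Qed.

(** [HFM] is quadratic: the remainder at [h] is exactly [pairing a h h]. *)
Lemma diff_HFM P : differentiable (HFM a) P /\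
  'd (HFM a) P = (fun Q => pairing P Q + pairing Q P) :> (_ -> _).
Proof.
have L : linear (fun Q => pairing P Q + pairing Q P).
  by move=> c Q Q'; rewrite pairingDr pairingDl pairingZr pairingZl scalerDr addrACA.
pose Lf : {linear 'M[R]_(d, d0) -> 'rV[R]_N} :=
  HB.pack_for {linear 'M[R]_(d, d0) -> 'rV[R]_N} (fun Q => pairing P Q + pairing Q P)
    (GRing.isLinear.Build _ _ _ _ _ L).
have [b b0 bP] := pairing_bounded.
apply: (@differentiable_eps_delta R _ _ (HFM a) P Lf).
  apply: (@lipschitz_continuous R _ _ _ (b * (2 * `|P|))) => Q Q'.
  rewrite -linearB /=; apply: (le_trans (ler_normD _ _)).
  have := bP P (Q - Q'); have := bP (Q - Q') P.
  by rewrite [`|Q - Q'| * _]mulrC; move: `|Q - Q'| `|P| => x y; lra.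
move=> e e0; exists (e / (b + 1)).
  by rewrite divr_gt0// ltr_wpDl.
move=> h hd.
have -> : HFM a (h + P) - HFM a P - Lf h = pairing h h.
  rewrite [h + P]addrC HFMD (_ : Lf h = pairing P h + pairing h P)// -HFM_pairing.
  by rewrite -addrA -opprD addrAC subrr add0r.
apply: (le_trans (bP h h)); rewrite mulrA ler_wpM2r//.
have b1 : 0 < b + 1 by rewrite ltr_wpDl.
rewrite ltr_pdivlMr// in hd; apply: le_trans (ltW hd).
by rewrite mulrC ler_wpM2l// lerDl.
Qed.

Lemma continuous_HFM : continuous (@HFM R d d0 a).
Proof. by move=> P; apply: differentiable_continuous; have [] := diff_HFM P. Qed.

End pairing.

(** Columns are added one at a time: as long as [P] and [E] together have fewer than [d] columns,
    some nonzero vector is orthogonal to all of them. *)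
Lemma orthonormal_complement (R : realType) (d c k : nat) (P : 'M[R]_(d, c)) :
  (c + k <= d)%N -> exists E : 'M[R]_(d, k), P^T *m E = 0 /\ E^T *m E = 1%:M.
Proof.
elim: k => [|k IH] ck.
  by exists 0; rewrite mulmx0; split => //; apply/matrixP => -[].
have [E [PE EE]] : exists E : 'M[R]_(d, k), P^T *m E = 0 /\ E^T *m E = 1%:M.
  by apply: IH; rewrite (leq_trans _ ck)// addnS.
have : kermx (row_mx P E) != 0.
  rewrite -mxrank_eq0 mxrank_ker subn_eq0 -ltnNge.
  by rewrite (leq_ltn_trans (rank_leq_col _))// -addnS.
move=> /rowV0Pn[u /sub_kermxP]; rewrite mul_mx_row -row_mx0 => /eq_row_mx[uP uE] u0.
have uu : 0 < dot u u.
  by rewrite lt_neqAle dot_ge0 andbT eq_sym; apply: contra_neq u0 => /dot_eq0.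
pose e : 'rV[R]_d := (Num.sqrt (dot u u))^-1 *: u.
have eP : e *m P = 0 by rewrite -scalemxAl uP scaler0.
have eE : e *m E = 0 by rewrite -scalemxAl uE scaler0.
have ee : e *m e^T = 1%:M.
  rewrite linearZ/= -scalemxAl -scalemxAr scalerA -expr2 exprVn sqr_sqrtr ?ltW//.
  apply/matrixP => i j; rewrite !ord1 !mxE eqxx mulr1n.
  rewrite (_ : \sum_k _ = dot u u) ?mulVf ?gt_eqF//.
  by rewrite /dot big_ord1; apply: eq_bigr => r _; rewrite mxE.
pose F : 'M[R]_(d, 1 + k) := row_mx e^T E.
have PF : P^T *m F = 0 by rewrite mul_mx_row PE -trmx_mul eP trmx0 row_mx0.
have FF : F^T *m F = 1%:M.
  rewrite tr_row_mx trmxK mul_col_row ee eE EE.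
  by rewrite -[E^T *m e^T]trmx_mul eE trmx0 -scalar_mx_block.
by exists F.
Qed.

(** A Cholesky-like elimination with the diagonal fixed at [e]. Each row follows from the earlier
    ones by a division by [e], and the bound reproduces itself: [delta] and the products contribute
    [e / (4 * N)] each. *)
Lemma triangular_gram (R : realType) (N : nat) (delta : nat -> nat -> R) (e : R) :
  (0 < N)%N -> 0 < e -> (forall i j, `|delta i j| <= e ^+ 2 / (4 * N%:R)) ->
  exists C : nat -> nat -> R, forall i j, (i < N)%N -> (i < j)%N ->
    \sum_(k < i) C k i * C k j + e * C i j = delta i j /\ `|C i j| <= e / (2 * N%:R).
Proof.
move=> N0 e0 hd.
have NR : 0 < N%:R :> R by rewrite ltr0n.
suff H n : (n <= N)%N -> exists C : nat -> nat -> R, forall i j, (i < n)%N -> (i < j)%N ->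
    \sum_(k < i) C k i * C k j + e * C i j = delta i j /\ `|C i j| <= e / (2 * N%:R).
  exact: H (leqnn N).
elim: n => [|n IH] nN; first by exists (fun _ _ => 0).
have [C HC] := IH (ltnW nN).
pose C' i j := if i == n then (delta n j - \sum_(k < n) C k n * C k j) / e else C i j.
have C'lt k j : (k < n)%N -> C' k j = C k j by move=> kn; rewrite /C' ltn_eqF.
exists C' => i j; rewrite ltnS leq_eqVlt => /orP[/eqP ->|ni] ij; last first.
  rewrite (eq_bigr (fun k : 'I_i => C k i * C k j)) => [|k _]; first by rewrite C'lt//; exact: HC.
  by rewrite !C'lt// (ltn_trans (ltn_ord k)).
rewrite (eq_bigr (fun k : 'I_n => C k n * C k j)) => [|k _]; last by rewrite !C'lt.
rewrite /C' eqxx mulrC divfK ?gt_eqF// subrKC; split => //.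
rewrite normrM normfV (gtr0_norm e0) ler_pdivrMr//.
have b : `|\sum_(k < n) C k n * C k j| <= N%:R * ((e / (2 * N%:R)) * (e / (2 * N%:R))).
  apply: (le_trans (ler_norm_sum _ _ _)).
  apply: (@le_trans _ _ (\sum_(k < n) ((e / (2 * N%:R)) * (e / (2 * N%:R))))).
    apply: ler_sum => k _; rewrite normrM ler_pM//.
      by have [] := HC k n (ltn_ord k) (ltn_ord k).
    by have [] := HC k j (ltn_ord k) (ltn_trans (ltn_ord k) ij).
  rewrite sumr_const card_ord -[leLHS]mulr_natl ler_wpM2r ?ler_nat 1?ltnW//.
  by rewrite mulr_ge0// divr_ge0// ?ltW// mulr_gt0.
apply: (le_trans (ler_normB _ _)); apply: (le_trans (lerD (hd _ _) b)).
rewrite le_eqVlt; apply/orP; left; apply/eqP; field.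
by rewrite gt_eqF.
Qed.

Section pair_indexing.
Context (d0 : nat).

Lemma lt_pair_lt (k : 'I_(d0.-1 * d0)./2) :
  ((Defs.lt_pair k).1 < (Defs.lt_pair k).2)%N.
Proof.
have : Defs.lt_pair k \in lt_pairs d0 by exact: mem_tnth.
by rewrite mem_filter => /andP[].
Qed.

Lemma lt_pair_inj : injective (@Defs.lt_pair d0).
Proof.
apply/tuple_uniqP; rewrite /= filter_uniq// allpairs_uniq ?enum_uniq//.
by move=> [i j] [i' j'].
Qed.

End pair_indexing.

(** The cross terms vanish, so the Gram matrix of [P + E *m Cm] is that of [P] plus [Cm^T *m Cm],
    whatever the rank of [P]; only the entries above the diagonal are prescribed. *)
Lemma HFM_open (R : realType) (d d0 : nat) (a : 'I_d0 -> 'I_d0 -> R)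
    (P : 'M[R]_(d, d0)) (eta : R) :
  (0 < d0)%N -> (2 * d0 - 1 <= d)%N ->
  (forall i j : 'I_d0, (i < j)%N -> a i j != 0) -> 0 < eta ->
  exists2 rho, 0 < rho & forall z, `|HFM a P - z| < rho ->
    exists2 P', `|P - P'| < eta & HFM a P' = z.
Proof.
move=> d00 hd ha eta0.
have [E [PE EE]] : exists E : 'M[R]_(d, d0.-1), P^T *m E = 0 /\ E^T *m E = 1%:M.
  apply: orthonormal_complement; apply: leq_trans hd.
  by rewrite mul2n -addnn -addnBA// subn1.
have EP : E^T *m P = 0 by rewrite -[LHS]trmxK trmx_mul trmxK PE trmx0.
(* Entries of [Cm] bounded by [e] give entries of [E *m Cm] bounded by [M * e], which is below
   [eta]. *)
pose M : R := d0%:R * `|E| + 1.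
have M0 : 0 < M by rewrite ltr_wpDl// mulr_ge0.
pose e : R := eta / M / 2.
have e0 : 0 < e by rewrite !divr_gt0.
pose b := (fun k => a (Defs.lt_pair k).1 (Defs.lt_pair k).2).
have b0 k : b k != 0 by apply: ha; exact: lt_pair_lt.
pose S : R := \sum_k `|b k|^-1.
have S0 : 0 <= S by apply: sumr_ge0 => k _; rewrite invr_ge0.
have d0R : 0 < d0%:R :> R by rewrite ltr0n.
(* [S] absorbs the divisions by [b k], so a change of [HFM] below [rho] meets the bound of
   [triangular_gram]. *)
pose rho := e ^+ 2 / (4 * d0%:R) / (S + 1).
have S1 : 0 < S + 1 by rewrite ltr_wpDl.
exists rho; first by rewrite !divr_gt0 ?exprn_gt0// mulr_gt0.
move=> z zrho.
(* The wanted change of the product of columns [i] and [j]. As [lt_pair] is injective, at most one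
   term is nonzero; other index pairs get 0. *)
pose delta (i j : nat) : R := \sum_k
  if ((Defs.lt_pair k).1 == i :> nat) && ((Defs.lt_pair k).2 == j :> nat)
  then (z - HFM a P) 0 k / b k else 0.
have hdelta i j : `|delta i j| <= e ^+ 2 / (4 * d0%:R).
  apply: (le_trans (ler_norm_sum _ _ _)).
  apply: (@le_trans _ _ (rho * S)).
    rewrite /S mulr_sumr; apply: ler_sum => k _; case: ifP => _; last first.
      by rewrite normr0 mulr_ge0// ?invr_ge0// (le_trans _ (ltW zrho)).
    rewrite normrM normfV ler_wpM2r ?invr_ge0//.
    by rewrite (le_trans (ler_entry_norm _ _ _))// distrC ltW.
  rewrite /rho mulrAC ler_pdivrMr// ler_wpM2l ?lerDl// divr_ge0 ?exprn_ge0 ?ltW//.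
  by rewrite mulr_gt0.
have deltaE k : delta (Defs.lt_pair k).1 (Defs.lt_pair k).2 = (z - HFM a P) 0 k / b k.
  rewrite /delta (bigD1 k)//= !eqxx/= big1 ?addr0// => k' k'k.
  case: ifP => // /andP[/eqP h1 /eqP h2]; move/eqP: k'k; case.
  apply: lt_pair_inj; move: h1 h2; case: (Defs.lt_pair k) => i j.
  by case: (Defs.lt_pair k') => i' j' /= /val_inj -> /val_inj ->.
have [C HC] := triangular_gram d00 e0 hdelta.
pose G (i j : nat) : R := if (i < j)%N then C i j else if i == j then e else 0.
pose Cm : 'M[R]_(d0.-1, d0) := \matrix_(i, j) G i j.
have GG (i j : 'I_d0) : (i < j)%N -> (Cm^T *m Cm) i j = delta i j.
  move=> ij; rewrite mxE (eq_bigr (fun k : 'I_d0.-1 => G k i * G k j)) => [|k _].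
    (* The row with the diagonal entry of column [i] exists, though [Cm] has one row less than
       columns, because [i < j]. *)
    have id0 : (i < d0.-1)%N.
      by rewrite -ltnS prednK// (leq_ltn_trans ij).
    have [<- _] := HC i j (ltn_ord i) ij.
    rewrite -(big_mkord xpredT (fun k => G k i * G k j)).
    rewrite (big_cat_nat (n := i.+1))//= [X in _ + X](_ : _ = 0) ?addr0; last first.
      rewrite big_nat_cond big1// => k /andP[/andP[ik _] _].
      by rewrite {1}/G ltnNge (ltnW ik)/= gtn_eqF// mul0r.
    rewrite big_nat_recr//= big_mkord; congr (_ + _); last by rewrite /G ltnn eqxx ij.
    by apply: eq_bigr => k _; rewrite /G (ltn_ord k) (ltn_trans (ltn_ord k)).
  by rewrite !mxE.
have Gle (i : 'I_d0.-1) (j : 'I_d0) : `|Cm i j| <= e.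
  rewrite mxE /G; case: ifP => ij.
    have [|_] := HC i j _ ij; first by rewrite (leq_trans (ltn_ord i))// leq_pred.
    move=> /le_trans; apply; rewrite ler_pdivrMr ?mulr_gt0// ler_peMr ?(ltW e0)//.
    by rewrite -natrM ler1n muln_gt0.
  by case: ifP => _; rewrite ?normr0 ?gtr0_norm// ltW.
exists (P + E *m Cm).
  rewrite opprD addrA subrr add0r normrN.
  apply: (@le_lt_trans _ _ (M * e)); last first.
    by rewrite /e mulrA mulrCA divff ?gt_eqF// mulr1 ltr_pdivrMr// ltr_pMr// ltr1n.
  apply: mx_norm_le => [|r j]; first by rewrite mulr_ge0 ?ltW.
  rewrite mxE; apply: (le_trans (ler_norm_sum _ _ _)).
  apply: (@le_trans _ _ (\sum_(k < d0.-1) `|E| * e)).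
    by apply: ler_sum => k _; rewrite normrM ler_pM// ler_entry_norm.
  rewrite sumr_const card_ord -[leLHS]mulr_natl mulrA ler_wpM2r ?(ltW e0)//.
  by rewrite /M (@le_trans _ _ (d0%:R * `|E|)) ?lerDl// ler_wpM2r// ler_nat leq_pred.
apply/rowP => k; rewrite HFM_pairing mxE.
have pE (Q : 'M[R]_(d, d0)) i j : \sum_r Q r i * Q r j = (Q^T *m Q) i j.
  by rewrite mxE; apply: eq_bigr => r _; rewrite mxE.
have trD : (P + E *m Cm)^T = P^T + (E *m Cm)^T by exact: raddfD.
rewrite pE trD mulmxDl !mulmxDr trmx_mul !mulmxA PE mul0mx addr0.
rewrite -[Cm^T *m E^T *m P]mulmxA EP mulmx0 add0r -[Cm^T *m E^T *m E]mulmxA EE mulmx1.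
rewrite mxE GG ?lt_pair_lt// deltaE mulrDr -pE.
rewrite -/(b k) [b k * (_ / _)]mulrCA divff// mulr1.
have HE : HFM a P 0 k = b k * \sum_r P r (Defs.lt_pair k).1 * P r (Defs.lt_pair k).2.
  by rewrite HFM_pairing mxE.
by rewrite -HE [(z - _) 0 k]mxE [(- HFM a P) 0 k]mxE subrKC.
Qed.

(** * The chain rule *)

Section chain_rule.
Context (R : realType) (d d0 : nat) (a : 'I_d0 -> 'I_d0 -> R).
Local Notation N := ((d0.-1 * d0)./2).

(** [HFM] being quadratic, [jacobian_tr] is bilinear in the point and the covector; the bound is the
    usual splitting of a difference, tested on [delta_mx i j]. *)
Lemma jacobian_tr_bounded : exists2 b : R, 0 <= b &
  forall (P P' : 'M[R]_(d, d0)) s s',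
  `|jacobian_tr (HFM a) P s - jacobian_tr (HFM a) P' s'| <=
  b * (`|s - s'| * `|P'| + `|s| * `|P - P'|).
Proof.
have [b b0 bP] := pairing_bounded d a.
exists ((1 * N)%:R * (2 * b)) => [|P P' s s']; first by rewrite !mulr_ge0.
apply: mx_norm_le => [|i j]; first by rewrite !(mulr_ge0, addr_ge0).
have Lle Q : `|pairing a Q (delta_mx i j) + pairing a (delta_mx i j) Q| <= 2 * b * `|Q|.
  apply: (le_trans (ler_normD _ _)); rewrite [2 * b]mulrDl mul1r mulrDl lerD//.
    apply: (le_trans (bP _ _)).
    by rewrite ler_wpM2l// ler_piMr// norm_delta_mx_le.
  apply: (le_trans (bP _ _)).
  by rewrite ler_wpM2l// ler_piMl// norm_delta_mx_le.
pose L Q := pairing a Q (delta_mx i j) + pairing a (delta_mx i j) Q.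
have jL Q t : dot (jacobian_tr (HFM a) Q t) (delta_mx i j) = dot t (L Q).
  by have [dQ dQE] := diff_HFM a Q; rewrite (dot_jacobian_tr _ _ dQ) dQE.
have LB : L (P - P') = L P - L P'.
  by rewrite /L -[- P']scaleN1r pairingDl pairingDr pairingZl pairingZr !scaleN1r opprD addrACA.
have -> : (jacobian_tr (HFM a) P s - jacobian_tr (HFM a) P' s') i j =
    dot (s - s') (L P') + dot s (L (P - P')).
  transitivity (dot (jacobian_tr (HFM a) P s - jacobian_tr (HFM a) P' s') (delta_mx i j)).
    by rewrite dot_delta.
  rewrite [LHS]dotBl !jL LB.
  by rewrite dotBl dotBr; ring.
apply: (le_trans (ler_normD _ _)); rewrite mulrDr lerD//.
  apply: (le_trans (normr_dot_le _ _)); rewrite -[leRHS]mulrA ler_wpM2l//.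
  by rewrite mulrCA ler_wpM2l// Lle.
apply: (le_trans (normr_dot_le _ _)); rewrite -[leRHS]mulrA ler_wpM2l//.
by rewrite mulrCA ler_wpM2l// Lle.
Qed.

Lemma continuous_jacobian_tr P : continuous (jacobian_tr (@HFM R d d0 a) P).
Proof.
have [b b0 bP] := jacobian_tr_bounded.
apply: (@lipschitz_continuous R _ _ _ (b * `|P|)) => s t.
have := bP P P s t.
by rewrite subrr normr0 mulr0 addr0 [`|s - t| * _]mulrC mulrA.
Qed.

Variable l : 'rV[R]_N -> R.
Hypothesis hl : locally_lipschitz l.

Lemma limiting_gradients_chain_ge (P : 'M[R]_(d, d0)) s : (0 < d0)%N -> (2 * d0 - 1 <= d)%N ->
  (forall i j : 'I_d0, (i < j)%N -> a i j != 0) ->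
  limiting_gradients l (HFM a P) s ->
  limiting_gradients (l \o HFM a) P (jacobian_tr (HFM a) P s).
Proof.
move=> d00 hd ha /limiting_gradientsP Hs; apply/limiting_gradientsP => e e0.
have [b b0 bP] := jacobian_tr_bounded.
pose M := b * ((`|P| + 1) + `|s|) + 1.
have M0 : 0 < M by rewrite ltr_wpDl// !(mulr_ge0, addr_ge0).
(* The bound 1 keeps the norm of [P'] below that of [P] plus 1, so that [M] can be fixed before [P']
   is known. *)
pose eta := Num.min (Num.min e 1) (e / M / 2).
have eta0 : 0 < eta by rewrite !lt_min e0 ltr01 !divr_gt0.
have [etae eta1 etaM] : [/\ eta <= e, eta <= 1 & eta <= e / M / 2].
  by split; rewrite /eta !ge_min lexx ?orbT.
clearbody eta.
have [rho rho0 Hrho] := HFM_open P d00 hd ha eta0.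
have mr : 0 < Num.min eta rho by rewrite lt_min eta0.
have [z []] := Hs _ mr; rewrite !lt_min => /andP[_ zrho] dl /andP[seta _].
have [P' PP' HP'] := Hrho z zrho.
have [dP' _] := diff_HFM a P'.
have dl' : differentiable l (HFM a P') by rewrite HP'.
have [dlH gE] := gradient_comp dP' dl'.
exists P'; split; [exact: lt_le_trans PP' etae|exact: dlH|].
rewrite gE HP'; apply: (le_lt_trans (bP _ _ _ _)).
have P'le : `|P'| <= `|P| + 1.
  rewrite -[P'](subrK P) [leRHS]addrC (le_trans (ler_normD _ _))// lerD2r distrC.
  by rewrite (le_trans (ltW PP')).
apply: (@le_lt_trans _ _ (b * (eta * ((`|P| + 1) + `|s|)))).
  rewrite ler_wpM2l// mulrDr lerD//; first by apply: ler_pM => //; exact: ltW.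
  by rewrite mulrC; apply: ler_wpM2r => //; exact: ltW.
apply: (@le_lt_trans _ _ (eta * M)).
  by rewrite mulrCA ler_wpM2l ?(ltW eta0)// /M lerDl.
apply: (@le_lt_trans _ _ (e / 2)); last by rewrite ltr_pdivrMr// ltr_pMr// ltr1n.
apply: (@le_trans _ _ (e / M / 2 * M)); first by rewrite ler_wpM2r// ltW.
by rewrite mulrAC divfK ?gt_eqF.
Qed.

(** The direction [u] is the differential at [P], not at the nearby [y], since
    [limiting_gradients_support] asks for a fixed one; the Lipschitz bound pays for replacing
    [HFM a (h *: v + y)] by [HFM a y + h *: u]. *)
Lemma limiting_gradients_direction (P : 'M[R]_(d, d0)) s v :
  limiting_gradients (l \o HFM a) P s ->
  exists2 t, limiting_gradients l (HFM a P) t &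
    dot s v <= dot (jacobian_tr (HFM a) P t) v.
Proof.
move=> /limiting_gradientsP Hs; have [B B0 BP] := pairing_bounded d a.
have [dP dPE] := diff_HFM a P.
pose u := 'd (HFM a) P v.
suff [t Ht ct] : exists2 t, limiting_gradients l (HFM a P) t & dot s v <= dot t u.
  by exists t => //; rewrite dot_jacobian_tr.
apply: (limiting_gradients_support hl) => e e0.
have [r [K [r0 K0 lK _ _]]] := locally_lipschitz_near hl (HFM a P).
pose w := `|v| + 1; have w0 : 0 < w by rewrite ltr_wpDl.
have e4 : 0 < e / 4 by rewrite divr_gt0.
have r2 : 0 < r / 2 by rewrite divr_gt0.
have er : 0 < Num.min e (r / 2) by rewrite lt_min e0.
(* A quarter of [e] goes to each of: [s] against the gradient at [y], differentiability at [y], [Ly]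
   against [u], and the second-order term of [HFM]. *)
pose M1 := (d * d0)%:R * w + 1; have M10 : 0 < M1 by rewrite ltr_wpDl// mulr_ge0// ltW.
pose M2 := K * (2 * B * w) + 1.
have M20 : 0 < M2 by rewrite ltr_wpDl// !mulr_ge0// ltW.
have /cvgrPdist_lt/(_ _ er) := @continuous_HFM R d d0 a P.
move=> /nbhs_ballP[dc /= dc0 Hdc].
have m0 : 0 < Num.min dc (Num.min (e / 4 / M1) (e / 4 / M2)).
  by rewrite !lt_min dc0 !divr_gt0.
have [y []] := Hs _ m0; rewrite !lt_min => /andP[ydc /andP[_ yM2]] dy /andP[_ /andP[sM1 _]].
have := Hdc y; rewrite ball_mxE/= lt_min => /(_ ydc)/andP[Hye Hyr].
have ew : 0 < e / 4 / w by rewrite divr_gt0.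
have := eps_differentiable dy ew; move=> /nbhs_ballP[dd /= dd0 Hdd].
pose g := gradient (l \o HFM a) y.
have gv : dot s v - e / 4 <= dot g v.
  have : `|dot (s - g) v| <= e / 4.
    apply: (le_trans (normr_dot_le _ _)); rewrite ltr_pdivlMr// in sM1.
    apply: le_trans (ltW sM1); rewrite mulrCA ler_wpM2l//.
    by rewrite (@le_trans _ _ ((d * d0)%:R * w)) ?lerDl// ler_wpM2l// lerDl.
  by rewrite dotBl ler_norml => /andP[_]; lra.
pose Ly := pairing a y v + pairing a v y.
near (0 : R)^'+ => h.
have h0 : 0 < h by near: h; exact: nbhs_right_gt.
have small (M q : R) : 0 <= M -> 0 < q -> h < q / (M + 1) -> h * M <= q.
  move=> M0 q0; rewrite ltr_pdivlMr ?ltr_wpDl// => /ltW; apply: le_trans.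
  by rewrite ler_pM2l// lerDl.
have h1 : h < 1 by near: h; exact: nbhs_right_lt.
have he : h < e by near: h; exact: nbhs_right_lt.
have hv : h < dd / 2 / (`|v| + 1).
  by near: h; apply: nbhs_right_lt; rewrite !divr_gt0// ltr_wpDl.
have hdd : h * `|v| < dd.
  have : h * `|v| <= dd / 2 by apply: small; rewrite ?divr_gt0.
  by move=> /le_lt_trans; apply; rewrite ltr_pdivrMr// ltr_pMr// ltr1n.
have hu : h * `|u| <= r / 2.
  apply: small => //; near: h; apply: nbhs_right_lt; rewrite divr_gt0// ltr_wpDl//.
have hB : h * (`|Ly| + B * (`|v| * `|v|)) <= r / 2.
  apply: small => //; first by rewrite !(addr_ge0, mulr_ge0).
  by near: h; apply: nbhs_right_lt; rewrite divr_gt0// ltr_wpDl// !(addr_ge0, mulr_ge0).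
have hKB : h * (K * (B * (`|v| * `|v|))) <= e / 4.
  apply: small => //; first by rewrite !(addr_ge0, mulr_ge0).
  by near: h; apply: nbhs_right_lt; rewrite divr_gt0// ltr_wpDl// !(addr_ge0, mulr_ge0).
exists (HFM a y), h; split; [exact: Hye|by rewrite h0|].
have Hexp : HFM a (h *: v + y) = HFM a y + h *: Ly + (h * h) *: pairing a v v.
  by rewrite addrC HFMD pairingZl pairingZr -scalerDr (HFM_pairing a (h *: v))
    pairingZl pairingZr scalerA.
have hh0 : 0 < h * h by rewrite mulr_gt0.
have nh (X : 'rV[R]_N) : `|h *: X| = h * `|X| by rewrite normrZ gtr0_norm.
have nhh (X : 'rV[R]_N) : `|(h * h) *: X| = h * h * `|X| by rewrite normrZ gtr0_norm.
have hh (X : R) : 0 <= X -> h * h * X <= h * X.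
  by move=> X0; rewrite ler_wpM2r// ler_piMl ?ltW.
have pvv : `|pairing a v v| <= B * (`|v| * `|v|) by exact: BP.
have in1 : `|HFM a P - HFM a (h *: v + y)| <= r.
  rewrite Hexp -addrA opprD addrA (le_trans (ler_normB _ _))// [leRHS]splitr lerD//.
    exact: ltW.
  apply: (le_trans (ler_normD _ _)); rewrite nh nhh.
  apply: le_trans hB; rewrite mulrDr lerD//.
  by apply: (le_trans (hh _ (normr_ge0 _))); rewrite ler_pM2l.
have in2 : `|HFM a P - (HFM a y + h *: u)| <= r.
  rewrite opprD addrA (le_trans (ler_normB _ _))// [leRHS]splitr lerD//; first exact: ltW.
  by rewrite normrZ gtr0_norm.
have Lu : `|Ly - u| <= 2 * B * (`|P - y| * w).
  have -> : Ly - u = pairing a (y - P) v + pairing a v (y - P).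
    rewrite /u dPE /Ly -[- P]scaleN1r pairingDl pairingDr pairingZl pairingZr.
    by rewrite !scaleN1r opprD addrACA.
  apply: (le_trans (ler_normD _ _)); rewrite [2 * B]mulrDl mul1r mulrDl.
  have vw : `|v| <= w by rewrite lerDl.
  rewrite lerD//; apply: (le_trans (BP _ _)); rewrite ler_wpM2l// distrC.
    by rewrite ler_wpM2l.
  by rewrite mulrC ler_wpM2l.
have lip := lK _ _ in1 in2.
have diffle : `|HFM a (h *: v + y) - (HFM a y + h *: u)| <=
    h * (2 * B * (`|P - y| * w)) + h * (h * (B * (`|v| * `|v|))).
  rewrite Hexp -[HFM a y + _ + _]addrA opprD addrACA subrr add0r addrAC -scalerBr.
  apply: (le_trans (ler_normD _ _)); rewrite nh nhh.
  by rewrite lerD ?ler_wpM2l ?(ltW h0)// -mulrA !ler_wpM2l ?(ltW h0).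
have Kdiff : K * `|HFM a (h *: v + y) - (HFM a y + h *: u)| <= h * (e / 2).
  apply: (le_trans (ler_wpM2l K0 diffle)).
  have q1 : K * (2 * B * (`|P - y| * w)) <= e / 4.
    rewrite ltr_pdivlMr// in yM2; apply: le_trans (ltW yM2).
    rewrite (_ : K * _ = `|P - y| * (K * (2 * B * w))); last by ring.
    by rewrite ler_wpM2l// /M2 lerDl.
  have := ler_wpM2l (ltW h0) q1; have := ler_wpM2l (ltW h0) hKB; lra.
have lin : `|l (HFM a (h *: v + y)) - l (HFM a y) - h * dot g v| <= e / 4 * h.
  have := Hdd (h *: v); rewrite ball_mxE/= sub0r normrN normrZ (gtr0_norm h0) => /(_ hdd).
  rewrite linearZ /= diff_gradient// -/g => /le_trans; apply.
  rewrite (_ : e / 4 / w * (h * `|v|) = e / 4 * h * (`|v| / w)); last by ring.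
  apply: ler_piMr; first by rewrite mulr_ge0// ltW.
  by rewrite ler_pdivrMr// mul1r lerDl.
have hg : h * (dot s v - e / 4) <= h * dot g v by rewrite ler_wpM2l// ltW.
have lip2 := le_trans lip Kdiff.
move: lip2 lin hg; rewrite !ler_norml => /andP[_ k1] /andP[k2 _] k3.
lra.
Unshelve. all: by end_near. Qed.

End chain_rule.

Theorem corollary3p13 (R : realType) (d d0 : nat)
    (hd : (0 < d)%N) (hd0 : (0 < d0)%N) (hdd0 : (2 * d0 - 1 <= d)%N)
    (a : 'I_d0 -> 'I_d0 -> R)
    (ha : forall i j : 'I_d0, (i < j)%N -> a i j != 0)
    (l : 'rV[R]_((d0.-1 * d0)./2) -> R) (hl : locally_lipschitz l)
    (P : 'M[R]_(d, d0)) :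
  clarke_subdiff (l \o HFM a) P =
    jacobian_tr (HFM a) P @` clarke_subdiff l (HFM a P).
Proof.
set J := jacobian_tr (HFM a) P; set A := limiting_gradients l (HFM a P).
have JD s t : J (s + t) = J s + J t.
  by have := linear_jacobian_tr (HFM a) P 1 s t; rewrite !scale1r.
have J0 : J 0 = 0 by apply: (addrI (J 0)); rewrite -JD !addr0.
have JZ c s : J (c *: s) = c *: J s.
  by have := linear_jacobian_tr (HFM a) P c s 0; rewrite -/J J0 !addr0.
have Jconv x y t : J (t *: x + (1 - t) *: y) = t *: J x + (1 - t) *: J y.
  by rewrite JD !JZ.
apply/seteqP; split.
  apply: convex_hull_min.
    apply/convex_setP => _ _ t t01 [x hx <-] [y hy <-].
    by exists (t *: x + (1 - t) *: y); [exact: convex_hull_convex|exact: Jconv].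
  (* At this depth, the dimension of the domain of [l], the iterated hull is both convex and
     compact. *)
  move=> s Hs; pose C := J @` iter_hull (d0.-1 * d0)./2 A.
  suff [x hx <-] : C s by exists x => //; exact: iter_hull_sub_convex_hull hx.
  apply: contrapT => Cs.
  have cC : compact C.
    apply: continuous_compact.
      apply: continuous_subspaceT; exact: continuous_jacobian_tr.
    by apply: compact_iter_hull; exact: compact_limiting_gradients.
  have AC t : A t -> C (J t).
    move=> At; exists t => //; elim: (X in iter_hull X) => // n IH.
    exists 1, t, t; split => //; first by rewrite ler01 lexx.
    by rewrite subrr scale0r addr0 scale1r.
  have [v [e [e0 sep]]] : exists v e, 0 < e /\ forall c, C c -> dot c v <= dot s v - e.
    apply: compact_convex_separation => //.
      move=> _ _ t t01 [x hx <-] [y hy <-].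
      by exists (t *: x + (1 - t) *: y); [exact: iter_hull_convex|exact: Jconv].
    (* The direction 0 serves only to produce some limiting gradient of [l], so that [C] is
       nonempty. *)
    by have [t At _] := limiting_gradients_direction hl 0 Hs; exists (J t); exact: AC.
  have [t At] := limiting_gradients_direction hl v Hs.
  by have := sep _ (AC t At); rewrite -/J; lra.
move=> _ [x hx <-]; move: x hx.
apply: (@convex_hull_min R 'rV[R]_((d0.-1 * d0)./2) A
  [set x | clarke_subdiff (l \o HFM a) P (J x)]).
  apply/convex_setP => x y t t01 /= hx hy; rewrite Jconv.
  exact: convex_hull_convex.
move=> s As /=; apply: sub_convex_hull.
exact: limiting_gradients_chain_ge hd0 hdd0 ha As.
Qed.
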